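(* Let $u\in\mathbf S$ with Legendre transform $f$, let $E$ be an $(n-k)$-dimensional face of $\Delta$ with associated chart $\mathsf U_k$, let $a,\kappa>0$ be constants, and write $\mathbb F=\mathbb F_E$, $V=\log\mathbb F$, $\mathbb A=-\square\log\mathbb F$, $\mathbf\Psi=\|\nabla\log\mathbb F\|_f^2$ and $P=\exp(\kappa\mathbb F^a)\sqrt{\mathbb F}\,\mathbf\Psi$. Then on $G(\mathsf U_k)$ (at points where $\mathbf\Psi\neq0$) $$\frac{\square P}{P}\ \ge\ \frac{\|V_{,A\bar B}\|_f^2}{2\mathbf\Psi}+a^2\kappa\,(1-2\kappa\mathbb F^a)\,\mathbb F^a\,\mathbf\Psi-\frac{2|\langle\nabla\mathbb A,\nabla V\rangle|}{\mathbf\Psi}-\Big(a\kappa\mathbb F^a+\frac12\Big)\mathbb A ,$$ where $\langle\cdot,\cdot\rangle$ denotes the inner product with respect to the metric $\Omega_f$.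
   Context: **Homogeneous toric bundle.** $G$ is a compact semisimple Lie group, $K$ is the centralizer in $G$ of a torus $S$, and $T\supset S$ is a maximal torus of $G$ (so $T\subset K$). The Lie algebras of $G,K,T$ are $\mathfrak g,\mathfrak k,\mathfrak h$. The center $Z(K)$ is an $n$-dimensional torus $T^n$. $(M,\omega)$ is a compact toric Kähler manifold of complex dimension $n$ with effective $T^n$-action, moment map $\tau$ and Delzant moment polytope $\bar\Delta$ ($\Delta$ is the open polytope). $\varrho:K\to T^n$ is a surjective homomorphism, and $G\times_K M=(G\times M)/\big((gh,x)\sim(g,\varrho(h)x)\big)$ carries its natural left $G$-action and $G$-invariant complex structure. For $U\subset M$, $G(U)\subset G\times_KM$ is the image of $U$ (in the fiber over $eK$) under the $G$-action. $T^n$-invariant functions on $M$ are extended $G$-invariantly to $G\times_KM$. **Roots.** $R$ is the root system of $(\mathfrak g^{\mathbb C},\mathfrak h^{\mathbb C})$, $R_K$ is the set of roots of $\mathfrak k^{\mathbb C}$, and $R_M=R\setminus R_K$. $\Pi=\{\alpha_1,\dots,\alpha_{n+\hbar}\}$ is a system of simple roots with $\Pi\cap R_K=\{\alpha_{n+1},\dots,\alpha_{n+\hbar}\}$. $R_M^+=R^+\setminus R_K^+$. Each $\alpha\in R^+$ is written $\alpha=\sum_{j=1}^{n+\hbar}M_\alpha^j\alpha_j$, $M_\alpha^j\ge0$. With $B$ the Killing form and $h_\alpha$ the $B$-dual of $\alpha$, let $\tilde h_{\alpha_j}$ ($j\le n$) be the projection of $h_{\alpha_j}$ that is $B$-orthogonal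 to $h_{\alpha_{n+1}},\dots,h_{\alpha_{n+\hbar}}$, and set $\tilde H_{\alpha_j}=\sqrt{-1}\,\tilde h_{\alpha_j}$. These form a basis of $\mathfrak t=\mathrm{Lie}(Z(K))$. $\nu^1,\dots,\nu^n$ is the dual basis of $\mathfrak t^*\cong\mathbb R^n$, with coordinates $\xi=(\xi_1,\dots,\xi_n)$ relative to a fixed origin $o$ and $\nu^i$. Set $D_\alpha(\xi)=2\sum_{j=1}^nM_\alpha^j\xi_j$ and $\mathbb D=\prod_{\alpha\in R_M^+}D_\alpha$. Standing assumption on the position of $\Delta$: $\bar\Delta\subset\{\xi_1>0,\dots,\xi_n>0\}$ and $\sum_{\alpha\in R_M^+}\frac{\sum_{j\le n}M_\alpha^j\,\mathrm{diam}(\Delta)}{D_\alpha(\xi)}<\frac n4$ for all $\xi\in\bar\Delta$. **Metrics.** If $\Delta=\{\delta_k>0,\ k=1,\dots,d\}$ with $\delta_k$ affine linear, each $\delta_k=0$ defining a facet, let $v=\sum_k\delta_k\log\delta_k$. $\mathbf S$ is the set of convex $u\in C(\bar\Delta)$ such that $u-v$ is smooth on $\bar\Delta$; as usual $u$ is strictly convex in $\Delta$ and defines a Kähler metric $\Omega_f$ (Riemannian metric $\mathcal G_f$) smooth on all of $G\times_KM$, as follows. Put $x^i=\partial u/\partial\xi_i$, $f(x)=\sum x^i\xi_i-u$ (so $\xi_i=\partial f/\partial x^i$), where $w^j=x^j+\sqrt{-1}y^j$ are log-affine complex coordinates on $\tau^{-1}(\Delta)\subset M$. On $G(\tau^{-1}(\Delta))$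 $$\mathcal G_f=\sum f_{ij}(dx^i\otimes dx^j+\nu^i\otimes\nu^j)+\sum_{\alpha\in R_M^+}D_\alpha(dV^\alpha\otimes dV^\alpha+dW^\alpha\otimes dW^\alpha),$$ where $f_{ij}=\partial^2f/\partial x^i\partial x^j$, and $\{dx^j,\nu^j,dV^\alpha,dW^\alpha\}$ is the coframe dual to $\{\partial/\partial x^j,\tilde H^*_{\alpha_j},V_\alpha^*,W_\alpha^*\}$, the fundamental vector fields of $\tilde H_{\alpha_j}$, $V_\alpha=e_\alpha-e_{-\alpha}$, $W_\alpha=\sqrt{-1}(e_\alpha+e_{-\alpha})$, with $e_{\pm\alpha}$ a Weyl basis normalized by $B(e_\alpha,e_{-\alpha})=1$. The $(1,0)$-frame is $S_j=\frac12(\partial_{x^j}-\sqrt{-1}\tilde H^*_{\alpha_j})$ ($j\le n$), $S_\alpha=\frac12(V_\alpha^*-\sqrt{-1}W_\alpha^* )$ ($\alpha\in R_M^+$). Indices $A,B,C,D$ run over $\{1,\dots,n\}\cup R_M^+$; '','' denotes covariant differentiation in this frame. The metric components in this frame are normalized as $f_{,j\bar k}=\frac14f_{jk}$, $f_{,\alpha\bar\beta}=\frac14\delta_{\alpha\beta}D_\alpha$, $f_{,j\bar\alpha}=0$, with inverse $(f^{A\bar B})$. **Operators on a function $F$ of $x$ only.** $F_{,j\bar k}=\frac14\frac{\partial^2F}{\partial x^j\partial x^k}$, $F_{,\alpha\bar\beta}=\frac14\delta_{\alpha\beta}\sum f^{kl}\frac{\partial D_\alpha}{\partial x^k}\frac{\partial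 F}{\partial x^l}$, $F_{,j\bar\alpha}=F_{,\alpha\bar j}=0$. The Laplacian is $\square F=\sum f^{A\bar B}F_{,A\bar B}=\sum f^{ij}\frac{\partial^2F}{\partial x^i\partial x^j}+\sum f^{ij}\frac{\partial\log\mathbb D}{\partial x^i}\frac{\partial F}{\partial x^j}$. For functions $F,H$ of $x$, $\langle\nabla F,\nabla H\rangle=\sum f^{ij}\frac{\partial F}{\partial x^i}\frac{\partial H}{\partial x^j}$ and $\|\nabla F\|_f^2=\langle\nabla F,\nabla F\rangle$. Finally $$\|V_{,A\bar B}\|_f^2=\sum f^{A\bar B}f^{C\bar D}V_{,A\bar D}V_{,C\bar B}=\sum f^{ij}f^{kl}V_{ik}V_{jl}+\sum_{\alpha\in R_M^+}\Big(\sum f^{kl}\frac{\partial\log D_\alpha}{\partial x^k}\frac{\partial V}{\partial x^l}\Big)^2 .$$ At points of $G(\mathsf U_k)$ outside $G(\tau^{-1}(\Delta))$ these quantities are understood invariantly, i.e. by smooth extension. **Face charts.** To an $(n-k)$-dimensional face $E$ of $\Delta$ is associated a complex chart $\mathsf U_k\cong\mathbb C^k\times(\mathbb C^* )^{n-k}$ of $M$: after a unimodular affine change of the coordinates $\xi$ (and the corresponding linear change of $x$) one has log-affine coordinates $w^i=x^i+\sqrt{-1}y^i$ such that, with $z^i=e^{w^i/2}$ for $i\le k$, $(z^1,\dots,z^k,w^{k+1},\dots,w^n)$ are holomorphic coordinates on $\mathsf U_k$, and $f_E=f-\sum_{i=1}^kc_ix^i-d$ (with constants $c_i,d$ chosen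 so that the moment map of $f_E$ maps $\{z^i=0,\ i\le k\}$ onto $E\subset\{\xi_i=0,\ i\le k\}$) extends smoothly to $\mathsf U_k$. In these coordinates $$\mathbb F_E=\det\Big(\frac{\partial^2f_E}{\partial x^i\partial x^j}\Big)e^{-\sum_{i=1}^kx^i}\,\mathbb D ,$$ which extends to a smooth positive function on $\mathsf U_k$. *)

(* Defs.v *)
From HB Require Import structures.
From mathcomp Require Import all_boot all_order all_algebra.
From mathcomp Require Import all_classical all_reals all_analysis.
Set Implicit Arguments.
Unset Strict Implicit.
Unset Printing Implicit Defensive.
Import Order.TTheory GRing.Theory Num.Theory.
Import numFieldNormedType.Exports.
Local Open Scope classical_set_scope.
Local Open Scope ring_scope.

(* The root data of (G, K, T) is described through the Lie algebra g of G. *)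

Record lie_bracket (R : realType) (g : vectType R) (br : g -> g -> g) : Prop := {
  br_linearr : forall x, linear (br x);
  br_alternating : forall x, br x x = 0;
  br_jacobi : forall x y z, br x (br y z) + br y (br z x) + br z (br x y) = 0 }.

Definition killing (R : realType) (g : vectType R) (br : g -> g -> g)
    (x y : g) : R :=
  let e := vbasis (@fullv R g) in \sum_i coord e i (br x (br y (tnth e i))).

(* Lie algebras of compact semisimple Lie groups: negative definite Killing
   form. *)
Definition compact_semisimple (R : realType) (g : vectType R)
    (br : g -> g -> g) : Prop :=
  lie_bracket br /\ forall x, x != 0 -> killing br x x < 0.

(* Lie algebra of a maximal torus. *)
Definition maximal_abelian (R : realType) (g : vectType R) (br : g -> g -> g)
    (h : {vspace g}) : Prop :=
  (forall x y, x \in h -> y \in h -> br x y = 0) /\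
  (forall x, (forall y, y \in h -> br x y = 0) -> x \in h).

Definition is_centralizer (R : realType) (g : vectType R) (br : g -> g -> g)
    (s k : {vspace g}) : Prop :=
  forall x, x \in k <-> forall y, y \in s -> br x y = 0.

Definition is_center (R : realType) (g : vectType R) (br : g -> g -> g)
    (k z : {vspace g}) : Prop :=
  forall x, x \in z <-> x \in k /\ forall y, y \in k -> br x y = 0.

(* The roots of (l^C, h^C) are imaginary on h: a root alpha = sqrt(-1) a is
   encoded by the real linear form a.  The pair (v, w) stands for the root
   vector v + sqrt(-1) w of l^C; the two equations are the real and imaginary
   parts of [H, v + sqrt(-1) w] = sqrt(-1) a(H) (v + sqrt(-1) w). *)
Definition is_root (R : realType) (g : vectType R) (br : g -> g -> g)
    (h l : {vspace g}) (a : 'Hom(subvs_of h, R^o)) : Prop :=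
  a != 0 /\
  exists v w : g, [/\ v \in l, w \in l, (v != 0) || (w != 0) &
    forall H : subvs_of h,
      br (vsval H) v = - (a H : R) *: w /\ br (vsval H) w = (a H : R) *: v].

Definition simple_system (R : realType) (g : vectType R) (br : g -> g -> g)
    (h : {vspace g}) (r : nat) (Pi : r.-tuple 'Hom(subvs_of h, R^o)) : Prop :=
  [/\ basis_of fullv Pi,
      forall j, is_root br fullv (tnth Pi j) &
      forall a, is_root br fullv a ->
        (forall j, coord Pi j a \is a Num.nat) \/
        (forall j, - coord Pi j a \is a Num.nat)].

Definition positive_root (R : realType) (g : vectType R) (br : g -> g -> g)
    (h : {vspace g}) (r : nat) (Pi : r.-tuple 'Hom(subvs_of h, R^o))
    (a : 'Hom(subvs_of h, R^o)) : Prop :=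
  is_root br fullv a /\ forall j, coord Pi j a \is a Num.nat.

(* h, s, k, z are the Lie algebras of T, S, K, Z(K); RM enumerates R_M^+. *)
Record flag_data (R : realType) (g : vectType R) (br : g -> g -> g)
    (h s k z : {vspace g}) (n hb m : nat)
    (Pi : (n + hb).-tuple 'Hom(subvs_of h, R^o))
    (RM : m.-tuple 'Hom(subvs_of h, R^o)) : Prop := {
  fd_g : compact_semisimple br;
  fd_h : maximal_abelian br h;
  fd_s : (s <= h)%VS;
  fd_k : is_centralizer br s k;
  fd_z : is_center br k z;
  fd_dim : \dim z = n;
  fd_Pi : simple_system br Pi;
  fd_PiK : forall j, is_root br k (tnth Pi j) <-> (n <= j)%N;
  fd_uniq : uniq RM;
  fd_RM : forall a, a \in RM <-> positive_root br Pi a /\ ~ is_root br k a }.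

(* The coefficient M_alpha^j, j <= n, of the i-th root alpha of R_M^+. *)
Definition root_coef (R : realType) (g : vectType R) (h : {vspace g})
    (n hb m : nat) (Pi : (n + hb).-tuple 'Hom(subvs_of h, R^o))
    (RM : m.-tuple 'Hom(subvs_of h, R^o)) (i : 'I_m) (j : 'I_n) : R :=
  coord Pi (lshift hb j) (tnth RM i).

(* xi holds the coordinates with respect to the basis nu^1, ..., nu^n of the
   dual of z. *)
Definition Droot (R : realType) (n m : nat) (M : 'I_m -> 'I_n -> R) (i : 'I_m)
    (xi : 'rV[R]_n) : R :=
  2 * \sum_j M i j * xi 0 j.

Fixpoint iter_derive (R : realType) (V : normedModType R) (vs : seq V)
    (f : V -> R) : V -> R :=
  if vs is v :: vs' then fun x => 'D_v (iter_derive vs' f) x else f.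

(* C^oo on an open subset of a finite dimensional space: all iterated
   directional derivatives exist and are continuous. *)
Definition smooth_on (R : realType) (V : normedModType R) (U : set V)
    (f : V -> R) : Prop :=
  forall (vs : seq V) x, U x ->
    {for x, continuous (iter_derive vs f)} /\
    forall v, derivable (iter_derive vs f) x v.

Definition pd (R : realType) (n : nat) (i : 'I_n) (F : 'rV[R]_n -> R)
    (x : 'rV[R]_n) : R :=
  'D_(delta_mx 0 i) F x.

Definition grad (R : realType) (n : nat) (F : 'rV[R]_n -> R) (x : 'rV[R]_n) :
    'rV[R]_n :=
  \row_i pd i F x.

Definition hess (R : realType) (n : nat) (F : 'rV[R]_n -> R) (x : 'rV[R]_n) :
    'M[R]_n :=
  \matrix_(i, j) pd i (pd j F) x.

Definition dot (R : realType) (n : nat) (x y : 'rV[R]_n) : R :=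
  \sum_i x 0 i * y 0 i.

(* The library norm on 'rV is the sup norm, hence this Euclidean diameter. *)
Definition diam (R : realType) (n : nat) (A : set 'rV[R]_n) : R :=
  sup [set r | exists x y, [/\ A x, A y & r = Num.sqrt (dot (x - y) (x - y))]].

(* The rows of L are a basis of the integral lattice of the torus T^n in its
   Lie algebra (L = 1 is the standard lattice); the rows of B are another one. *)
Definition lattice_basis (R : realType) (n : nat) (L B : 'M[R]_n) : Prop :=
  exists2 U : 'M[int]_n, U \in unitmx & B = map_mx intr U *m L.

Definition delta (R : realType) (n d : nat) (N : 'M[R]_(d, n)) (b : 'rV[R]_d)
    (l : 'I_d) (xi : 'rV[R]_n) : R :=
  dot (row l N) xi + b 0 l.

Definition polytope (R : realType) (n d : nat) (N : 'M[R]_(d, n))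
    (b : 'rV[R]_d) : set 'rV[R]_n :=
  [set xi | forall l, 0 < delta N b l xi].

Definition face (R : realType) (n d : nat) (N : 'M[R]_(d, n)) (b : 'rV[R]_d)
    (I : {set 'I_d}) : set 'rV[R]_n :=
  [set xi | closure (polytope N b) xi /\
            forall l, l \in I -> delta N b l xi = 0].

(* The affine hull of E is p + rowspace B, of dimension m. *)
Definition affine_dim (R : realType) (n : nat) (E : set 'rV[R]_n) (m : nat) :
    Prop :=
  exists p (B : 'M[R]_(m, n)),
    [/\ E p, row_free B, forall i, E (p + row i B) &
        forall q, E q -> (q - p <= B)%MS].

Definition face_of_dim (R : realType) (n d : nat) (N : 'M[R]_(d, n))
    (b : 'rV[R]_d) (E : set 'rV[R]_n) (m : nat) : Prop :=
  (exists I, E = face N b I) /\ affine_dim E m.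

Record delzant (R : realType) (n d : nat) (L : 'M[R]_n) (N : 'M[R]_(d, n))
    (b : 'rV[R]_d) : Prop := {
  dz_lattice : L \in unitmx;
  dz_nonempty : polytope N b !=set0;
  dz_compact : compact (closure (polytope N b));
  dz_facet : forall l, exists xi,
    delta N b l xi = 0 /\ forall l', l' != l -> 0 < delta N b l' xi;
  dz_vertex : forall p, face_of_dim N b [set p] 0 ->
    exists s : 'I_n -> 'I_d, [/\ injective s,
      forall l, delta N b l p = 0 <-> exists i, l = s i &
      lattice_basis L (\matrix_i row (s i) N)] }.

(* ln 0 = 0 in the library, so this is continuous up to the boundary. *)
Definition guillemin (R : realType) (n d : nat) (N : 'M[R]_(d, n))
    (b : 'rV[R]_d) (xi : 'rV[R]_n) : R :=
  \sum_l delta N b l xi * ln (delta N b l xi).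

(* The class S; smoothness of u - v on the closed polytope means that u - v is
   the restriction of a smooth function defined on a neighbourhood of it. *)
Record symplectic_potential (R : realType) (n d : nat) (N : 'M[R]_(d, n))
    (b : 'rV[R]_d) (u : 'rV[R]_n -> R) : Prop := {
  sp_cont : {within closure (polytope N b), continuous u};
  sp_convex : forall xi eta t, closure (polytope N b) xi ->
    closure (polytope N b) eta -> 0 <= t <= 1 ->
    u (t *: xi + (1 - t) *: eta) <= t * u xi + (1 - t) * u eta;
  sp_strict : forall xi eta t, polytope N b xi -> polytope N b eta ->
    xi != eta -> 0 < t < 1 ->
    u (t *: xi + (1 - t) *: eta) < t * u xi + (1 - t) * u eta;
  sp_smooth : exists (O : set 'rV[R]_n) (w : 'rV[R]_n -> R),
    [/\ open O, closure (polytope N b) `<=` O, smooth_on O w &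
        forall xi, closure (polytope N b) xi -> u xi - guillemin N b xi = w xi] }.

Definition legendre (R : realType) (n : nat) (Delta : set 'rV[R]_n)
    (u f : 'rV[R]_n -> R) : Prop :=
  forall xi, Delta xi -> f (grad u xi) = dot (grad u xi) xi - u xi.

Definition position_assumption (R : realType) (n m : nat)
    (M : 'I_m -> 'I_n -> R) (Delta : set 'rV[R]_n) : Prop :=
  forall xi, closure Delta xi ->
    (forall i, 0 < xi 0 i) /\
    \sum_a (\sum_j M a j * diam Delta) / Droot M a xi < n%:R / 4.

(* In the operators below f is the potential, D a x stands for D_alpha
   as a function of x; the indices A, B, ... run over 'I_(n + m), i.e.
   {1, ..., n} followed by R_M^+.  All components are real. *)

Definition metric (R : realType) (n m : nat) (f : 'rV[R]_n -> R)
    (D : 'I_m -> 'rV[R]_n -> R) (x : 'rV[R]_n) : 'M[R]_(n + m) :=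
  block_mx (4^-1 *: hess f x) 0 0 (diag_mx (\row_a (4^-1 * D a x))).

Definition inner (R : realType) (n : nat) (f F H : 'rV[R]_n -> R)
    (x : 'rV[R]_n) : R :=
  \sum_i \sum_j invmx (hess f x) i j * pd i F x * pd j H x.

Definition chess (R : realType) (n m : nat) (f : 'rV[R]_n -> R)
    (D : 'I_m -> 'rV[R]_n -> R) (F : 'rV[R]_n -> R) (x : 'rV[R]_n) :
    'M[R]_(n + m) :=
  block_mx (4^-1 *: hess F x) 0 0
    (diag_mx (\row_a (4^-1 *
      \sum_k \sum_l invmx (hess f x) k l * pd k (D a) x * pd l F x))).

Definition laplacian (R : realType) (n m : nat) (f : 'rV[R]_n -> R)
    (D : 'I_m -> 'rV[R]_n -> R) (F : 'rV[R]_n -> R) (x : 'rV[R]_n) : R :=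
  \sum_A \sum_B invmx (metric f D x) A B * chess f D F x A B.

Definition chess_norm2 (R : realType) (n m : nat) (f : 'rV[R]_n -> R)
    (D : 'I_m -> 'rV[R]_n -> R) (F : 'rV[R]_n -> R) (x : 'rV[R]_n) : R :=
  let G := invmx (metric f D x) in let H := chess f D F x in
  \sum_A \sum_B \sum_C \sum_E G A B * G C E * H A E * H C B.

(* A point of U_k is given by its holomorphic coordinates
   (z^1, ..., z^k, w^{k+1}, ..., w^n); p.1 and p.2 are their real and imaginary
   parts.  The coordinates w^i are only defined modulo 4 pi sqrt(-1) Z, but the
   functions considered are torus-invariant, so it is enough to work on the
   covering C^k x C^(n-k) of U_k. *)
Definition chart_point (R : realType) (n : nat) : Type :=
  ('rV[R]_n * 'rV[R]_n)%type.

Definition in_open_orbit (R : realType) (n k : nat) (p : chart_point R n) :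
    Prop :=
  forall i : 'I_n, (i < k)%N -> p.1 0 i != 0 \/ p.2 0 i != 0.

(* x^i = log |z^i|^2 for i <= k, since z^i = e^(w^i / 2). *)
Definition log_coord (R : realType) (n k : nat) (p : chart_point R n) :
    'rV[R]_n :=
  \row_i (if (i < k)%N then ln (p.1 0 i ^+ 2 + p.2 0 i ^+ 2) else p.1 0 i).

Definition smooth_extension (R : realType) (n k : nat) (Q : 'rV[R]_n -> R)
    (Qh : chart_point R n -> R) : Prop :=
  @smooth_on R ('rV[R]_n * 'rV[R]_n)%type setT Qh /\
  forall p, in_open_orbit k p -> Qh p = Q (log_coord k p).

(* c is the value at p of the invariant quantity given by Q on the open orbit:
   Q itself there, and the value of its smooth extension elsewhere. *)
Definition value_at (R : realType) (n k : nat) (Q : 'rV[R]_n -> R)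
    (p : chart_point R n) (c : R) : Prop :=
  (in_open_orbit k p -> c = Q (log_coord k p)) /\
  (~ in_open_orbit k p -> exists2 Qh, smooth_extension k Q Qh & c = Qh p).

(* The chart of E is given by the affine change xi |-> A xi - c, where the rows
   of A form a basis of the lattice, with the corresponding linear change
   x |-> x *m A back to the original x.  The k first new coordinates are the
   defining functions of the facets through E.  Only c_i, i <= k, matters. *)
Definition face_chart (R : realType) (n d : nat) (L : 'M[R]_n)
    (N : 'M[R]_(d, n)) (b : 'rV[R]_d) (E : set 'rV[R]_n) (k : nat)
    (A : 'M[R]_n) (c : 'rV[R]_n) : Prop :=
  [/\ lattice_basis L A,
      forall i : 'I_n, (i < k)%N ->
        exists l, forall xi, dot (row i A) xi - c 0 i = delta N b l xi &
      E = [set xi | closure (polytope N b) xi /\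
             forall i : 'I_n, (i < k)%N -> dot (row i A) xi - c 0 i = 0]].

Definition chart_potential (R : realType) (n : nat) (A : 'M[R]_n)
    (f : 'rV[R]_n -> R) (x : 'rV[R]_n) : R :=
  f (x *m A).

Definition face_potential (R : realType) (n k : nat) (A : 'M[R]_n)
    (c : 'rV[R]_n) (e : R) (f : 'rV[R]_n -> R) (x : 'rV[R]_n) : R :=
  chart_potential A f x - \sum_(i < n | (i < k)%N) c 0 i * x 0 i - e.

(* D_alpha at the point xi = grad f of the polytope. *)
Definition chart_D (R : realType) (n m : nat) (M : 'I_m -> 'I_n -> R)
    (A : 'M[R]_n) (f : 'rV[R]_n -> R) (a : 'I_m) (x : 'rV[R]_n) : R :=
  Droot M a (grad f (x *m A)).

Definition FE (R : realType) (n m k : nat) (fE : 'rV[R]_n -> R)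
    (D : 'I_m -> 'rV[R]_n -> R) (x : 'rV[R]_n) : R :=
  \det (hess fE x) * expR (- \sum_(i < n | (i < k)%N) x 0 i) * \prod_a D a x.

(* Main.v *)
Require Import Defs.
From HB Require Import structures.
From mathcomp Require Import all_boot all_order all_algebra.
From mathcomp Require Import all_classical all_reals all_analysis.
From mathcomp Require Import perm ring lra.
Import Order.TTheory GRing.Theory Num.Theory.
Import numFieldNormedType.Exports.
Local Open Scope classical_set_scope.
Local Open Scope ring_scope.
Set Implicit Arguments.
Unset Strict Implicit.
Unset Printing Implicit Defensive.

(** On the open orbit everything is a function of [x].  Write [T] for the third
    derivatives of the potential, [G] for the inverse of its Hessian,
    [X = G grad V], and let [S = hess V - T(X)] be the covariant pure Hessian of
    [V].  Differentiating [hess f X = grad V] gives [dX = G S], and [V] differs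
    from [log det (hess f) + log prod_a D_a] by a linear function, so the
    Laplacian is the divergence for the weight [exp V] times an exponential of
    a linear function.  Hence the Bochner formula
    [box Psi = 2 <grad box V, grad V> + |S|^2 + |V_{,A Bbar}|^2 - V(X, X)].
    With [P = exp(phi(V)) Psi] and [t = a kappa F^a], so that
    [phi'(V) = t + 1/2], the terms of [box P / P] that are not controlled are
    absorbed by completing the squares [|S + phi' dV dV|^2] and
    [|hess V + 2 t dV dV|^2 / 2].

    The Hessian of the potential is positive definite: [det <> 0] since [F > 0],
    and the potential is supported by an affine function at every point, because
    [grad u] is onto by the logarithmic behaviour of [u] at the facets.
    Points outside the open orbit are reached by letting a path in the open
    orbit tend to them. *)

(** * Smooth functions *)

(** [V] plays two parts: its gradient is what [Psi] measures, and up to a linear term it is the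
    logarithm of the weight of the Laplacian. In the directions [x^j] its complex Hessian is
    therefore minus the Ricci curvature, and this is where [- V(X, X)] in the Bochner formula comes
    from. The factor [sqrt F] of [P] is made for that term: it shifts [phi'] from [t] to [t + 1/2],
    so that [(2 phi' - 1) V(X, X) = 2 t V(X, X)]. Half of [|hess V|^2] absorbs this at the price
    [2 t^2 Psi^2], which is the summand [- 2 a^2 kappa^2 F^(2 a) Psi] of the claim. The fourth
    derivatives of the potential produced by [box Psi] are never evaluated: they recur in the second
    derivatives of log det (hess f), which [V] supplies. Smoothness is known only for extensions on
    the chart and only through directional derivatives. It is carried over to functions of [x] by
    restricting the extensions to the positive real points of the chart. *)

Lemma is_derive_line (R : realType) (V : normedModType R) (F : V -> R)
    (x v : V) (t : R) : derivable F (x + t *: v) v ->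
  is_derive t (1 : R) (fun s : R => F (x + s *: v)) ('D_v F (x + t *: v)).
Proof.
move=> dF.
have e : (fun h : R => h^-1 *: (((fun s : R => F (x + s *: v)) \o shift t)
      (h *: (1 : R)) - F (x + t *: v))) =
    (fun h : R => h^-1 *: ((F \o shift (x + t *: v)) (h *: v)
      - F (x + t *: v))).
  apply/funext => h /=; congr (_ *: (F _ - _)).
  by rewrite [h%:A]mulr1 scalerDl addrCA.
apply: DeriveDef; first by rewrite /derivable e.
by rewrite /derive e.
Qed.

(** Bounding [s] by [|t|] instead of placing it in an interval covers both signs of [t]: coordinate
    increments have no fixed sign. *)
Lemma MVT_line (R : realType) (V : normedModType R) (F : V -> R) (v : V) :
  (forall y, derivable F y v) -> forall (x : V) (t : R),
  exists2 s : R, `|s| <= `|t| & F (x + t *: v) - F x = t * 'D_v F (x + s *: v).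
Proof.
move=> dF x t.
have dg s : is_derive s (1 : R) (fun s : R => F (x + s *: v))
    ('D_v F (x + s *: v)) by exact: is_derive_line.
have cg : continuous (fun s : R => F (x + s *: v)).
  by move=> s; apply/differentiable_continuous/derivable1_diffP; case: (dg s).
have [t0|t0] := leP 0 t.
  have [|s si] := @MVT_segment R _ _ 0 t t0 (fun s _ => dg s).
    exact: continuous_subspaceT.
  rewrite scale0r addr0 subr0 => ->; exists s; last by rewrite mulrC.
  by move: si; rewrite in_itv /= => /andP[s0 st]; rewrite !ger0_norm.
have [|s si] := @MVT_segment R _ _ t 0 (ltW t0) (fun s _ => dg s).
  exact: continuous_subspaceT.
rewrite scale0r addr0 sub0r => e; exists s.
  move: si; rewrite in_itv /= => /andP[st s0].
  by rewrite !ler0_norm ?lerN2 // ltW.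
by rewrite -opprB e mulrN opprK mulrC.
Qed.

Lemma normr_row_le (R : realType) (n : nat) (x : 'rV[R]_n) (e : R) :
  0 <= e -> (forall i, `|x 0 i| <= e) -> `|x| <= e.
Proof.
move=> e0 xe; rewrite [leLHS]/Num.Def.normr/= mx_normrE.
by apply: bigmax_le => // -[i j] _ /=; rewrite ord1.
Qed.

Lemma normr_row_ge (R : realType) (n : nat) (x : 'rV[R]_n) i :
  `|x 0 i| <= `|x|.
Proof.
rewrite [leRHS]/Num.Def.normr/= mx_normrE.
by apply/bigmax_geP; right => /=; exists (0, i).
Qed.

(** The bridge from directional derivatives, through which the extensions are known, to Frechet
    differentiability, on which the product and chain rules rest. The increment is split into one
    step per coordinate, each handled by the mean value theorem. *)
Lemma differentiable_pd (R : realType) (n : nat) (F : 'rV[R]_n -> R) x :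
  (forall i y, derivable F y (delta_mx 0 i)) ->
  (forall i, {for x, continuous (pd i F)}) -> differentiable F x.
Proof.
move=> dF cF.
pose df (h : 'rV[R]_n) : R := \sum_i h 0 i * pd i F x.
have lin_df : linear df.
  move=> k u v; rewrite /df scaler_sumr -big_split /=; apply: eq_bigr => i _.
  by rewrite !mxE mulrDl -mulrA.
have cdf : continuous df.
  rewrite (_ : df = \sum_i (fun h : 'rV[R]_n => h 0 i * pd i F x)); last first.
    by apply/funext => y; rewrite fct_sumE.
  move=> h; apply: differentiable_continuous; apply: differentiable_sum => i.
  by apply: differentiableM => //; exact: differentiable_coord.
pose dfM := GRing.isLinear.Build _ _ _ _ _ lin_df.
pose dfL : {linear _ -> _} := HB.pack df dfM.
have H : (F : 'rV[R]_n -> R^o) \o shift x =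
    cst (F x : R^o) + (df : 'rV[R]_n -> R^o) +o_ (0 : 'rV[R]_n) id.
  apply/(@eqaddoP R _ R^o 'rV[R]_n) => _/posnumP[eps].
  (* Each of the [n] coordinate steps may cost [e']; [n.+1] keeps the quotient meaningful for
     [n = 0]. *)
  pose e' := eps%:num / n.+1%:R.
  have e'0 : 0 < e' by rewrite divr_gt0.
  have near_pd : \forall y \near x, forall i, `|pd i F x - pd i F y| <= e'.
    apply: (@filter_forall _ _ (fun i y => `|pd i F x - pd i F y| <= e')
      (nbhs x) _) => i.
    by have /cvgrPdist_le := cF i; exact.
  have /nbhs_ballP[d /= d0] := near_pd; rewrite -ball_normE => near_d.
  near=> h.
  have hd : `|h| < d by near: h; apply/nbhs_ballP; exists d => // y;
    rewrite -ball_normE /= sub0r normrN.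
  rewrite !fctE /= /df.
  (* A staircase from 0 to [h]: [hj j] keeps the first [j] coordinates of [h]. *)
  pose hj j : 'rV[R]_n := \row_i (if (i < j)%N then h 0 i else 0).
  have hjS (j : 'I_n) : hj j.+1 = hj j + h 0 j *: delta_mx 0 j.
    apply/rowP => i; rewrite !mxE /= ltnS leq_eqVlt -val_eqE /=.
    have [ij|ij] := eqVneq (i : nat) (j : nat).
      by rewrite ij ltnn add0r mulr1 (ord_inj ij).
    by rewrite mulr0 addr0.
  have hj0 : hj 0%N = 0 by apply/rowP => i; rewrite !mxE.
  have hjn : hj n = h by apply/rowP => i; rewrite !mxE ltn_ord.
  have tel : F (h + x) - F x = \sum_(j < n) (F (x + hj j.+1) - F (x + hj j)).
    rewrite -[RHS](big_mkord xpredT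
      (fun j => F (x + hj j.+1) - F (x + hj j))).
    by rewrite telescope_sumr // hjn hj0 addr0 (addrC x).
  rewrite opprD addrA tel -sumrB.
  apply: (le_trans (ler_norm_sum _ _ _)).
  apply: (@le_trans _ _ (\sum_(j < n) e' * `|h|)); last first.
    rewrite sumr_const card_ord -mulrnAl ler_wpM2r // /e' -mulr_natr mulrAC.
    by rewrite ler_pdivrMr // ler_pM2l // ler_nat.
  apply: ler_sum => j _.
  have [s sh e] := MVT_line (dF j) (x + hj j) (h 0 j).
  rewrite hjS addrA e -/(pd j F _) -mulrBr normrM mulrC; apply: ler_pM => //.
    rewrite distrC; apply: near_d.
    rewrite /= -addrA opprD addNKr normrN; apply: le_lt_trans hd.
    apply: normr_row_le => // i; rewrite !mxE /=.
    have [ij|ij] := ltnP i j.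
      by rewrite (_ : i == j = false) ?mulr0 ?addr0 ?normr_row_ge //;
         apply/eqP => ij'; rewrite ij' ltnn in ij.
    rewrite add0r; case: (i == j); rewrite ?mulr1 ?mulr0 ?normr0 //.
    exact: le_trans sh (normr_row_ge _ _).
  exact: normr_row_ge.
apply/diff_locallyP; rewrite (@diff_unique _ _ _ _ dfL _ cdf H); split => //.
Unshelve. all: by end_near.
Qed.

Lemma is_derive_shiftr (R : realType) (V : normedModType R) (F : V -> R)
    (c y v : V) : derivable F (y + c) v ->
  is_derive y v (fun z => F (z + c)) ('D_v F (y + c)).
Proof.
move=> dF.
have e : (fun h : R => h^-1 *: (((fun z => F (z + c)) \o shift y) (h *: v)
      - F (y + c))) =
    (fun h : R => h^-1 *: ((F \o shift (y + c)) (h *: v) - F (y + c))).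
  by apply/funext => h /=; rewrite addrA.
by apply: DeriveDef; rewrite /derivable /derive e.
Qed.

Lemma delta_mx_norm_le (R : realType) (n : nat) (i : 'I_n) :
  `|delta_mx 0 i : 'rV[R]_n| <= 1.
Proof.
apply: normr_row_le => // j; rewrite mxE /=.
by case: (j == i); rewrite ?normr1 ?normr0.
Qed.

Lemma continuous_dist_le2 (R : realType) (V : normedModType R) (F G : V -> R)
    (x : V) (e : R) :
  {for x, continuous F} -> {for x, continuous G} -> 0 < e ->
  exists2 d : R, 0 < d & forall y, `|x - y| < d ->
    `|F x - F y| <= e /\ `|G x - G y| <= e.
Proof.
move=> /cvgrPdist_le cF /cvgrPdist_le cG e0.
have /nbhs_ballP[d1 d10 H1] := cF _ e0.
have /nbhs_ballP[d2 d20 H2] := cG _ e0.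
exists (Num.min d1 d2) => [|y]; first by rewrite lt_min d10.
rewrite lt_min => /andP[xy1 xy2].
by split; [apply: H1|apply: H2]; rewrite -ball_normE.
Qed.

(** * Symmetry of second derivatives *)

Section schwarz.
Variables (R : realType) (n : nat) (F : 'rV[R]_n -> R).
Hypothesis dF : forall i y, derivable F y (delta_mx 0 i).
Hypothesis ddF : forall i j y, derivable (pd i F) y (delta_mx 0 j).

(** The mean value theorem twice, along [i] for the difference in direction [j], then along [j]. The
    second difference on the left is symmetric in [i] and [j], so its two instances equate the two
    mixed derivatives at points near [x]. *)
Let mixed_difference i j (H := pd j (pd i F)) x (t : R) :
  exists2 y, `|x - y| <= `|t| + `|t| &
  F (x + t *: delta_mx 0 i + t *: delta_mx 0 j) - F (x + t *: delta_mx 0 i)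
  - (F (x + t *: delta_mx 0 j) - F x) = t * (t * H y).
Proof.
pose c : 'rV[R]_n := t *: delta_mx 0 j.
have dg y : is_derive y (delta_mx 0 i) (fun z => F (z + c) - F z)
    (pd i F (y + c) - pd i F y).
  by apply: is_deriveB; [exact: is_derive_shiftr|exact: derivableP].
have [s st e1] := MVT_line (fun y => @ex_derive _ _ _ _ _ _ _ (dg y)) x t.
have [s' st' e2] := MVT_line (@ddF i j) (x + s *: delta_mx 0 i) t.
exists (x + s *: delta_mx 0 i + s' *: delta_mx 0 j).
  rewrite -addrA opprD addNKr opprD (le_trans (ler_normB _ _))//.
  rewrite normrN !normrZ lerD //.
    by rewrite -[leRHS]mulr1 ler_pM // delta_mx_norm_le.
  by rewrite -[leRHS]mulr1 ler_pM // delta_mx_norm_le.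
by rewrite e1 (@derive_val _ _ _ _ _ _ _ (dg _)) e2.
Qed.

Lemma pd_comm i j x : {for x, continuous (pd i (pd j F))} ->
  {for x, continuous (pd j (pd i F))} -> pd i (pd j F) x = pd j (pd i F) x.
Proof.
have := @mixed_difference j i x; have := @mixed_difference i j x.
move: (pd i (pd j F)) (pd j (pd i F)) => G H /= mG mH cG cH.
apply/eqP; rewrite -subr_eq0 -normr_le0.
apply/ler_addgt0Pr => e e0; rewrite add0r.
have e20 : 0 < e / 2 by rewrite divr_gt0.
have [d d0 nd] := continuous_dist_le2 cG cH e20.
(* The points found lie within [2 * |t|] of [x], hence the 3. *)
pose t := d / 3.
have t0 : 0 < t by rewrite divr_gt0.
have td : `|t| + `|t| < d by rewrite gtr0_norm // /t; lra.
have [y1 /le_lt_trans/(_ td)/nd[_ h1] e1] := mG t.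
have [y2 /le_lt_trans/(_ td)/nd[h2 _] e2] := mH t.
have e3 : H y1 = G y2.
  have tn0 : t != 0 by rewrite gt_eqF.
  apply: (mulfI tn0); apply: (mulfI tn0); rewrite -e1 -e2 (addrAC x).
  move: (F _) (F _) (F _) (F _) => a1 a2 a3 a4.
  by ring.
rewrite e3 in h1; rewrite (splitr e).
rewrite (le_trans (ler_distD (G y2) _ _))//.
by rewrite lerD // distrC.
Qed.

End schwarz.

(* Locked because a failing unification of [pd i _] with [pd j _] would unfold
   both sides down to limits. *)
HB.lock Definition partial (R : realType) (n : nat) (i : 'I_n)
  (F : 'rV[R]_n -> R) : 'rV[R]_n -> R := pd i F.

Lemma partialE (R : realType) (n : nat) (i : 'I_n) (F : 'rV[R]_n -> R) :
  partial i F = pd i F.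
Proof. by rewrite partial.unlock. Qed.

Section partial_rules.
Variables (R : realType) (n : nat).
Implicit Types (F G : 'rV[R]_n -> R) (x : 'rV[R]_n) (i j : 'I_n).

Lemma partial_cst (c : R) i x : partial i (fun=> c) x = 0.
Proof. by rewrite partialE; exact: derive_cst. Qed.

Lemma partialD F G i x : differentiable F x -> differentiable G x ->
  partial i (fun y => F y + G y) x = partial i F x + partial i G x.
Proof. by move=> dF dG; rewrite !partialE; apply: deriveD;
  exact: diff_derivable. Qed.

Lemma partialN F i x : differentiable F x -> partial i (fun y => - F y) x = -
  partial i F x.
Proof. by move=> dF; rewrite !partialE; apply: deriveN;
  exact: diff_derivable. Qed.

Lemma partialB F G i x : differentiable F x -> differentiable G x ->
  partial i (fun y => F y - G y) x = partial i F x - partial i G x.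
Proof. by move=> dF dG; rewrite !partialE; apply: deriveB;
  exact: diff_derivable. Qed.

Lemma partialM F G i x : differentiable F x -> differentiable G x ->
  partial i (fun y => F y * G y) x = F x * partial i G x + G x * partial i F x.
Proof. by move=> dF dG; rewrite !partialE; apply: deriveM;
  exact: diff_derivable. Qed.

Lemma partialZ (c : R) F i x : differentiable F x ->
  partial i (fun y => c * F y) x = c * partial i F x.
Proof. by move=> dF; rewrite partialM // partial_cst mulr0 addr0. Qed.

Lemma partialV F i x : differentiable F x -> F x != 0 ->
  partial i (fun y => (F y)^-1) x = - (F x) ^- 2 * partial i F x.
Proof. by move=> dF F0; rewrite !partialE; apply: deriveV => //;
  exact: diff_derivable. Qed.

Lemma differentiable_sumf (I : Type) (r : seq I) (F : I -> 'rV[R]_n -> R) x :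
  (forall k, differentiable (F k) x) ->
  differentiable (fun y => \sum_(k <- r) F k y) x.
Proof.
move=> dF; elim: r => [|k r IH].
  rewrite (_ : (fun y => _) = cst 0) //.
  by apply/funext => y; rewrite big_nil.
rewrite (_ : (fun y => _) = F k + (fun y => \sum_(k <- r) F k y)).
  exact: differentiableD.
by apply/funext => y; rewrite big_cons.
Qed.

Lemma partial_sum (I : Type) (r : seq I) (F : I -> 'rV[R]_n -> R) i x :
  (forall k, differentiable (F k) x) ->
  partial i (fun y => \sum_(k <- r) F k y) x = \sum_(k <- r) partial i (F k) x.
Proof.
move=> dF; elim: r => [|k r IH].
  rewrite big_nil -[RHS](partial_cst 0 i x); congr (partial i _ x).
  by apply/funext => y; rewrite big_nil.
rewrite big_cons -IH -partialD //; last exact: differentiable_sumf.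
by congr (partial i _ x); apply/funext => y; rewrite big_cons.
Qed.

Lemma derive_comp (h : R -> R) F x v : differentiable F x ->
  derivable h (F x) 1 ->
  'D_v (fun y => h (F y)) x = 'D_1 h (F x) * 'D_v F x.
Proof.
move=> dF /derivable1_diffP dh.
rewrite deriveE; last exact: differentiable_comp.
rewrite (@diff_comp _ _ _ _ F h) // /= diff1E // -deriveE //.
by rewrite derive1E mulrC.
Qed.

Lemma partial_expR F i x : differentiable F x ->
  partial i (fun y => expR (F y)) x = expR (F x) * partial i F x.
Proof.
move=> dF; rewrite !partialE /pd (@derive_comp expR) //.
by rewrite (@derive_val _ _ _ _ _ _ _ (is_derive_expR _)).
Qed.

Lemma partial_ln F i x : differentiable F x -> 0 < F x ->
  partial i (fun y => ln (F y)) x = (F x)^-1 * partial i F x.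
Proof.
move=> dF F0; have H := is_derive1_ln F0.
rewrite !partialE /pd (@derive_comp (@ln R)) //.
by rewrite (@derive_val _ _ _ _ _ _ _ H).
Qed.

Lemma differentiable_expR F x : differentiable F x ->
  differentiable (fun y => expR (F y)) x.
Proof.
move=> dF; apply: (@differentiable_comp _ _ _ _ F expR) => //.
exact/derivable1_diffP.
Qed.

Lemma differentiable_ln F x : differentiable F x -> 0 < F x ->
  differentiable (fun y => ln (F y)) x.
Proof.
move=> dF F0; apply: (@differentiable_comp _ _ _ _ F (@ln R)) => //.
by apply/derivable1_diffP; have H := is_derive1_ln F0.
Qed.

End partial_rules.

Lemma hessE (R : realType) (n : nat) (F : 'rV[R]_n -> R) x i j :
  hess F x i j = partial i (partial j F) x.
Proof. by rewrite mxE !partialE. Qed.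

Section smooth.
Variables (R : realType) (n : nat).
Implicit Types (F G : 'rV[R]_n -> R) (x : 'rV[R]_n) (i j : 'I_n) (k : nat).

(** Class C^k in Frechet form on the whole space: in logarithmic coordinates the open orbit is all
    of ['rV_n], so no domain is carried along. Induction on [k] gives stability under the usual
    operations. *)
Fixpoint diffk k F : Prop := if k is k'.+1 then
  (forall x, differentiable F x) /\ forall i, diffk k' (partial i F) else True.

Definition smooth F := forall k, diffk k F.

Lemma diffkS k F : diffk k.+1 F -> diffk k F.
Proof.
elim: k F => [//|k IH] F [dF ddF]; split => // i; exact: IH.
Qed.

Lemma smooth_diff F : smooth F -> forall x, differentiable F x.
Proof. by move=> /(_ 1%N)[]. Qed.

Lemma smooth_partial F i : smooth F -> smooth (partial i F).
Proof. by move=> sF k; have [_] := sF k.+1; exact. Qed.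

Lemma smooth_continuous F : smooth F -> continuous F.
Proof. by move=> sF x; exact/differentiable_continuous/smooth_diff. Qed.

Lemma diffk_cst (c : R) k : diffk k (fun=> c).
Proof.
elim: k c => // k IH c; split => [x|i]; first exact: differentiable_cst.
rewrite (_ : partial i _ = fun=> 0) //; apply/funext => x; exact: partial_cst.
Qed.

Lemma diffkD k F G : diffk k F -> diffk k G -> diffk k (fun x => F x + G x).
Proof.
elim: k F G => // k IH F G [dF ddF] [dG ddG]; split => [x|i].
  exact: differentiableD.
rewrite (_ : partial i _ = fun x => partial i F x + partial i G x).
  exact: IH (ddF i) (ddG i).
by apply/funext => x; exact: partialD.
Qed.

Lemma diffkM k F G : diffk k F -> diffk k G -> diffk k (fun x => F x * G x).
Proof.
elim: k F G => // k IH F G dkF dkG.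
have [[dF ddF] [dG ddG]] := (dkF, dkG); split => [x|i].
  exact: differentiableM.
rewrite (_ : partial i _ = fun x => F x * partial i G x + G x * partial i F x).
  by apply: diffkD; apply: IH => //;
    first [exact: diffkS|exact: ddF|exact: ddG].
by apply/funext => x; exact: partialM.
Qed.

Lemma smooth_cst (c : R) : smooth (fun=> c).
Proof. by move=> k; exact: diffk_cst. Qed.

Lemma smoothD F G : smooth F -> smooth G -> smooth (fun x => F x + G x).
Proof. by move=> sF sG k; exact: diffkD. Qed.

Lemma smoothM F G : smooth F -> smooth G -> smooth (fun x => F x * G x).
Proof. by move=> sF sG k; exact: diffkM. Qed.

Lemma smoothN F : smooth F -> smooth (fun x => - F x).
Proof.
move=> sF; rewrite (_ : (fun x => - F x) = fun x => - 1 * F x).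
  by apply: smoothM => //; exact: smooth_cst.
by apply/funext => x; rewrite mulN1r.
Qed.

Lemma smoothB F G : smooth F -> smooth G -> smooth (fun x => F x - G x).
Proof. by move=> sF sG; apply: smoothD => //; exact: smoothN. Qed.

Lemma smooth_sum (I : Type) (r : seq I) (P : pred I) (F : I -> 'rV[R]_n -> R) :
  (forall l, P l -> smooth (F l)) -> smooth (fun x => \sum_(l <- r | P l) F l
    x).
Proof.
move=> sF; elim: r => [|l r IH].
  rewrite (_ : (fun x => _) = fun=> 0); first exact: smooth_cst.
  by apply/funext => x; rewrite big_nil.
rewrite (_ : (fun x => _) = if P l then
    fun x => F l x + \sum_(l <- r | P l) F l x
  else fun x => \sum_(l <- r | P l) F l x).
  by case: ifPn => // Pl; apply: smoothD => //; exact: sF.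
by apply/funext => x; rewrite big_cons; case: ifP.
Qed.

Lemma smooth_prod (I : Type) (r : seq I) (F : I -> 'rV[R]_n -> R) :
  (forall l, smooth (F l)) -> smooth (fun x => \prod_(l <- r) F l x).
Proof.
move=> sF; elim: r => [|l r IH].
  rewrite (_ : (fun x => _) = fun=> 1); first exact: smooth_cst.
  by apply/funext => x; rewrite big_nil.
rewrite (_ : (fun x => _) = fun x => F l x * \prod_(l <- r) F l x).
  exact: smoothM.
by apply/funext => x; rewrite big_cons.
Qed.

Lemma smooth_coord i : smooth (fun x => x 0 i).
Proof.
case=> // k; split => [x|j]; first exact: differentiable_coord.
rewrite (_ : partial j _ = fun=> (delta_mx 0 j : 'rV[R]_n) 0 i).
  exact: diffk_cst.
apply/funext => x; rewrite partialE /pd.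
apply: cvg_lim => //=.
apply: cvg_near_cst; near=> h; have h0 : h != 0 by near: h;
  exact: nbhs_dnbhs_neq.
by rewrite !mxE addrK [_ *: _]mulrA mulVf // mul1r.
Unshelve. all: by end_near. Qed.

Lemma smooth_expR F : smooth F -> smooth (fun x => expR (F x)).
Proof.
move=> sF; elim=> // k IH; split => [x|i].
  exact/differentiable_expR/smooth_diff.
rewrite (_ : partial i _ = fun x => expR (F x) * partial i F x).
  by apply: diffkM => //; exact: smooth_partial.
by apply/funext => x; exact/partial_expR/smooth_diff.
Qed.

Lemma smoothV F : smooth F -> (forall x, F x != 0) -> smooth (fun x => (F
  x)^-1).
Proof.
move=> sF F0; elim=> // k IH; split => [x|i].
  exact/differentiableV/F0/smooth_diff.
rewrite (_ : partial i _ = fun x => (-1 * ((F x)^-1 * (F x)^-1)) * partial i F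
  x).
  apply: diffkM; last exact: smooth_partial.
  by apply: diffkM; [exact: diffk_cst|exact: diffkM].
apply/funext => x; rewrite partialV //; last exact: smooth_diff.
by rewrite expr2 invfM mulN1r.
Qed.

Lemma smooth_ln F : smooth F -> (forall x, 0 < F x) -> smooth (fun x => ln (F
  x)).
Proof.
move=> sF F0 [//|k]; split => [x|i].
  exact/differentiable_ln/F0/smooth_diff.
rewrite (_ : partial i _ = fun x => (F x)^-1 * partial i F x).
  apply: diffkM; last exact: smooth_partial.
  by apply: smoothV => // x; rewrite gt_eqF.
by apply/funext => x; exact/partial_ln/F0/smooth_diff.
Qed.

Lemma partialC_pt F i j x : smooth F ->
  partial i (partial j F) x = partial j (partial i F) x.
Proof.
move=> sF; have e a b : pd a (pd b F) = partial a (partial b F).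
  by rewrite !partialE.
rewrite -(e i j) -(e j i); apply: pd_comm.
- by move=> a y; apply: diff_derivable; exact: smooth_diff.
- move=> a b y; rewrite -(partialE a F).
  by apply: diff_derivable; exact/smooth_diff/smooth_partial.
- rewrite e; exact/smooth_continuous/smooth_partial/smooth_partial.
- rewrite e; exact/smooth_continuous/smooth_partial/smooth_partial.
Qed.

Lemma derive_pd F x v : differentiable F x -> 'D_v F x = \sum_i v 0 i * partial
  i F x.
Proof.
move=> dF; rewrite deriveE // {1}(row_sum_delta v) linear_sum.
by apply: eq_bigr => i _; rewrite linearZ /= -deriveE // partialE.
Qed.

Lemma smooth_det m (M : 'rV[R]_n -> 'M[R]_m) :
  (forall a b, smooth (fun x => M x a b)) -> smooth (fun x => \det (M x)).
Proof.
move=> sM; apply: smooth_sum => s _; apply: smoothM; first exact: smooth_cst.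
by apply: smooth_prod => a.
Qed.

Lemma smooth_invmx m (M : 'rV[R]_n -> 'M[R]_m) :
  (forall a b, smooth (fun x => M x a b)) -> (forall x, \det (M x) != 0) ->
  forall a b, smooth (fun x => invmx (M x) a b).
Proof.
move=> sM M0 a b.
rewrite (_ : (fun x => _) = fun x => (\det (M x))^-1 * cofactor (M x) b a).
  apply: smoothM; first by apply: smoothV => //; exact: smooth_det.
  apply: smoothM; first exact: smooth_cst.
    apply: smooth_det => c e.
  rewrite (_ : (fun x => _) = fun x => M x (lift b c) (lift a e));
    first exact: sM.
  by apply/funext => x; rewrite !mxE.
apply/funext => x.
by rewrite /invmx unitmxE unitfE M0 !mxE.
Qed.

End smooth.

(** * Derivatives of products and determinants *)

Lemma differentiable_prodf (R : realType) (n : nat) (I : Type) (r : seq I)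
    (F : I -> 'rV[R]_n -> R) x :
  (forall l, differentiable (F l) x) ->
  differentiable (fun y => \prod_(l <- r) F l y) x.
Proof.
move=> dF; elim: r => [|l r IH].
  rewrite (_ : (fun y => _) = cst 1) //.
  by apply/funext => y; rewrite big_nil.
rewrite (_ : (fun y => _) = fun y => F l y * \prod_(l <- r) F l y).
  exact: differentiableM.
by apply/funext => y; rewrite big_cons.
Qed.

Lemma partial_prod (R : realType) (n : nat) (I : finType)
    (F : I -> 'rV[R]_n -> R) i x :
  (forall l, differentiable (F l) x) ->
  partial i (fun y => \prod_l F l y) x =
  \sum_l partial i (F l) x * \prod_(a | a != l) F a x.
Proof.
move=> dF.
suff H r : uniq r -> partial i (fun y => \prod_(l <- r) F l y) x =
    \sum_(l <- r) partial i (F l) x * \prod_(a <- r | a != l) F a x.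
  exact: H (index_enum_uniq _).
elim: r => [_|l r IH /= /andP[lr ur]].
  rewrite big_nil (_ : (fun y => _) = fun=> 1); first exact: partial_cst.
  by apply/funext => y; rewrite big_nil.
rewrite (_ : (fun y => _) = fun y => F l y * \prod_(l <- r) F l y); last first.
  by apply/funext => y; rewrite big_cons.
rewrite partialM //; last exact: differentiable_prodf.
rewrite IH // [RHS]big_cons big_cons eqxx /= addrC; congr (_ + _).
  rewrite mulrC [in RHS]big_seq_cond [in LHS]big_seq.
  congr (_ * _); apply: eq_bigl => a.
  by case: eqP => [->|]; rewrite ?(negPf lr) ?andbT.
rewrite mulr_sumr big_seq [RHS]big_seq; apply: eq_bigr => a ar.
rewrite big_cons; case: eqP => [al|_]; first by rewrite al ar in lr.
by rewrite mulrCA.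
Qed.

Lemma partial_det (R : realType) (n m : nat) (M : 'rV[R]_n -> 'M[R]_m) k x :
  (forall a b, differentiable (fun y => M y a b) x) ->
  partial k (fun y => \det (M y)) x =
  \sum_a \sum_b partial k (fun y => M y a b) x * cofactor (M x) a b.
Proof.
move=> dM; rewrite /determinant.
rewrite (@partial_sum _ _ _ _ (fun (s : 'S_m) y => (-1) ^+ s * \prod_i M y i (s
  i)));
  last first.
  move=> s; apply: differentiableM; first exact: differentiable_cst.
  exact: differentiable_prodf.
(* [D a] is [M] with row [a] differentiated; its expansion along that row has the cofactors of [M]
   itself, which do not see row [a]. *)
pose D a : 'M[R]_m := \matrix_(c, e)
  if c == a then partial k (fun y => M y a e) x else M x c e.
transitivity (\sum_a \det (D a)); last first.
  apply: eq_bigr => a _; rewrite (expand_det_row _ a); apply: eq_bigr => b _.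
  rewrite mxE eqxx; congr (_ * _); rewrite /cofactor; congr (_ * \det _).
  by apply/matrixP => c e; rewrite !mxE eq_sym (negPf (neq_lift _ _)).
rewrite /determinant exchange_big /=; apply: eq_bigr => s _.
rewrite partialZ; last exact: differentiable_prodf.
rewrite partial_prod // mulr_sumr; apply: eq_bigr => a _; congr (_ * _).
rewrite [RHS](bigD1 a) //= mxE eqxx; congr (_ * _).
by apply: eq_bigr => c ca; rewrite mxE (negPf ca).
Qed.

Lemma partialC (R : realType) (n : nat) (F : 'rV[R]_n -> R) i j :
  smooth F -> partial i (partial j F) = partial j (partial i F).
Proof. by move=> sF; apply/funext => x; exact: partialC_pt. Qed.

(** * Calculus with the Hessian of a potential *)

Section hessian_potential.
Variables (R : realType) (n : nat) (f : 'rV[R]_n -> R).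
Hypothesis sf : smooth f.
Hypothesis f0 : forall x, \det (hess f x) != 0.
Implicit Types (x : 'rV[R]_n) (i j k l : 'I_n).

Local Notation H i j := (partial i (partial j f)).
Local Notation G x := (invmx (hess f x)).
Local Notation T i j k := (partial i (partial j (partial k f))).

Let sH i j : smooth (H i j). Proof. exact/smooth_partial/smooth_partial. Qed.
Let sT i j k : smooth (T i j k). Proof. exact/smooth_partial. Qed.

Lemma hess_unit x : hess f x \in unitmx.
Proof. by rewrite unitmxE unitfE. Qed.

Lemma hess_tr (F : 'rV[R]_n -> R) x : smooth F -> (hess F x)^T = hess F x.
Proof. by move=> sF; apply/matrixP => i j; rewrite mxE !hessE partialC_pt. Qed.

Lemma inv_hess_tr x : (G x)^T = G x.
Proof. by rewrite trmx_inv hess_tr. Qed.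

Lemma inv_hess_sym x i j : G x i j = G x j i.
Proof. by rewrite -[in LHS]inv_hess_tr mxE. Qed.

Lemma smooth_inv_hess i j : smooth (fun x => G x i j).
Proof.
apply: smooth_invmx => // a b.
by rewrite (_ : (fun x => _) = H a b) //; apply/funext => x; rewrite hessE.
Qed.

Lemma third_swapl i j k : T i j k = T j i k.
Proof. exact/partialC/smooth_partial. Qed.

Lemma third_swapr i j k : T i j k = T i k j.
Proof. by rewrite (partialC j k). Qed.

(** Jacobi's formula, the cofactors being the determinant times entries of the inverse. The double
    sum is thus the derivative of log det (hess f), written [tau] in the Bochner section. *)
Lemma partial_det_hess k x : partial k (fun y => \det (hess f y)) x =
  \det (hess f x) * \sum_i \sum_j G x i j * T k i j x.
Proof.
have e a b : (fun y => hess f y a b) = H a b.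
  by apply/funext => y; rewrite hessE.
rewrite partial_det; last first.
  by move=> a b; rewrite e; exact: smooth_diff.
rewrite mulr_sumr; apply: eq_bigr => i _; rewrite mulr_sumr.
apply: eq_bigr => j _; rewrite e inv_hess_sym /invmx hess_unit.
by rewrite !mxE -mulrA mulVKf // mulrC.
Qed.

Section inverse_image.
Variables (q c : 'I_n -> 'rV[R]_n -> R).
Hypothesis sq : forall i, smooth (q i).
Hypothesis Hq : forall i x, \sum_j H i j x * q j x = c i x.

(** Differentiate [hess f q = c] and solve for the derivative of [q]. It serves with [q] the
    gradient of [V] and with [q] a column of the inverse Hessian. *)
Lemma partial_inverse_image k j x : partial k (q j) x =
  \sum_i G x j i * (partial k (c i) x - \sum_l T k i l x * q l x).
Proof.
have e i : partial k (c i) x - \sum_l T k i l x * q l x =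
    \sum_l H i l x * partial k (q l) x.
  have <- : (fun y => \sum_j H i j y * q j y) = c i.
    by apply/funext => y; exact: Hq.
  rewrite (@partial_sum _ _ _ _ (fun j y => H i j y * q j y)); last first.
    by move=> l; apply: differentiableM; exact: smooth_diff.
  rewrite -sumrB; apply: eq_bigr => l _.
  rewrite partialM; [|exact: smooth_diff..].
  by rewrite [q l x * _]mulrC addrK.
under eq_bigr do rewrite e mulr_sumr.
rewrite exchange_big /=.
under eq_bigr do (under eq_bigr do rewrite mulrA; rewrite -mulr_suml).
have GH l : \sum_i G x j i * H i l x = (j == l)%:R.
  have /matrixP/(_ j l) := mulVmx (hess_unit x).
  by rewrite !mxE => <-; apply: eq_bigr => i _; rewrite hessE.
under eq_bigr do rewrite GH.
rewrite (bigD1 j) //= eqxx mul1r big1 ?addr0 // => l lj.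
by rewrite eq_sym (negPf lj) mul0r.
Qed.

(** The mechanism that turns second-order operators into divergences: by symmetry of the third
    derivatives, the correction from differentiating [hess f] is the derivative of log det (hess f)
    along [q]. *)
Lemma trace_inverse_image x :
  \sum_k \sum_i G x k i * partial k (c i) x =
  \sum_j (partial j (q j) x + (\sum_k \sum_i G x k i * T j k i x) * q j x).
Proof.
rewrite big_split /=.
under [X in _ = X + _]eq_bigr => j _.
  rewrite partial_inverse_image; under eq_bigr do rewrite mulrBr.
  rewrite sumrB; over.
rewrite sumrB -[LHS]addr0 -addrA; congr (_ + _).
apply/esym/eqP; rewrite addrC subr_eq0; apply/eqP.
under eq_bigr do (rewrite mulr_suml; under eq_bigr do rewrite mulr_suml).
rewrite exchange_big /=; apply: eq_bigr => k _; rewrite exchange_big /=.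
apply: eq_bigr => i _; rewrite mulr_sumr; apply: eq_bigr => j _.
by rewrite (third_swapl j k) (third_swapr k j) mulrA.
Qed.

End inverse_image.

Lemma partial_inv_hess k i j x : partial k (fun y => G y i j) x =
  - \sum_a \sum_b G x i a * T k a b x * G x b j.
Proof.
rewrite (@partial_inverse_image (fun a y => G y a j) (fun a _ => (a == j)%:R)).
- rewrite -sumrN; apply: eq_bigr => a _; rewrite partial_cst sub0r mulrN.
  congr (- _); rewrite mulr_sumr; apply: eq_bigr => b _; exact: mulrA.
- by move=> a; exact: smooth_inv_hess.
- move=> a y; have /matrixP/(_ a j) := mulmxV (hess_unit y).
  by rewrite !mxE => <-; apply: eq_bigr => b _; rewrite hessE.
Qed.

End hessian_potential.

(** * The Bochner formula *)

(** The derivative of [log prod_a D_a], written without a logarithm so that it makes sense as soon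
    as no [D a] vanishes. *)
Definition dlog_weight (R : realType) (n m : nat) (D : 'I_m -> 'rV[R]_n -> R)
    (i : 'I_n) (x : 'rV[R]_n) : R :=
  \sum_a (D a x)^-1 * partial i (D a) x.

Definition weighted_laplacian (R : realType) (n m : nat) (f : 'rV[R]_n -> R)
    (D : 'I_m -> 'rV[R]_n -> R) (F : 'rV[R]_n -> R) (x : 'rV[R]_n) : R :=
  \sum_i \sum_j invmx (hess f x) i j * partial i (partial j F) x
  + \sum_i dlog_weight D i x * \sum_j invmx (hess f x) i j * partial j F x.

Section bochner.
Variables (R : realType) (n m : nat) (f V : 'rV[R]_n -> R).
Variables (C : 'I_m -> 'I_n -> R) (D : 'I_m -> 'rV[R]_n -> R) (lin : 'I_n -> R).
Hypotheses (sf : smooth f) (sV : smooth V).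
Hypothesis f0 : forall x, \det (hess f x) != 0.
Hypothesis DE : forall a, D a = fun x => \sum_i C a i * partial i f x.
Hypothesis D0 : forall a x, D a x != 0.

Local Notation H i j := (partial i (partial j f)).
Local Notation G x := (invmx (hess f x)).
Local Notation T i j k := (partial i (partial j (partial k f))).
Local Notation w := (dlog_weight D).
Local Notation L := (weighted_laplacian f D).
Local Notation tau j x := (\sum_k \sum_i G x k i * T j k i x).

(** As [tau] is the derivative of log det (hess f), this says that [V] is the logarithm of
    [det (hess f) prod_a D_a] minus a linear function with coefficients [lin], up to a constant. *)
Hypothesis dV : forall j x, partial j V x = tau j x + w j x - lin j.

Definition gradient (j : 'I_n) (x : 'rV[R]_n) : R :=
  \sum_i G x j i * partial i V x.
Local Notation X := gradient.

Let sH i j : smooth (H i j). Proof. exact/smooth_partial/smooth_partial. Qed.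
Let sT i j k : smooth (T i j k). Proof. exact/smooth_partial. Qed.
Let sdV i : smooth (partial i V). Proof. exact: smooth_partial. Qed.

Let sX j : smooth (X j).
Proof.
apply: smooth_sum => i _; apply: smoothM => //; exact: smooth_inv_hess.
Qed.

Let sD a : smooth (D a).
Proof.
rewrite DE; apply: smooth_sum => i _; apply: smoothM; first exact: smooth_cst.
exact: smooth_partial.
Qed.

Let sw i : smooth (w i).
Proof.
apply: smooth_sum => a _; apply: smoothM; last exact: smooth_partial.
exact: smoothV.
Qed.

Let HG x i k : \sum_j H i j x * G x j k = (i == k)%:R.
Proof.
have /matrixP/(_ i k) := mulmxV (hess_unit f0 x).
by rewrite !mxE => <-; apply: eq_bigr => j _; rewrite hessE.
Qed.

Let HX i x : \sum_j H i j x * X j x = partial i V x.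
Proof.
rewrite /gradient; under eq_bigr do rewrite mulr_sumr.
rewrite exchange_big /=.
under eq_bigr do (under eq_bigr do rewrite mulrA; rewrite -mulr_suml HG).
rewrite (bigD1 i) //= eqxx mul1r big1 ?addr0 // => l li.
by rewrite eq_sym (negPf li) mul0r.
Qed.

(** Up to constant factors, the Christoffel symbols of the metric with potential [f] are [G T] in
    the coordinates [w^j]; contracted with the differential of [V] they give the correction [T(X)].
    Pure second derivatives acquire it, mixed ones do not. *)
Definition cov_hess (x : 'rV[R]_n) : 'M[R]_n :=
  \matrix_(i, k) (partial k (partial i V) x - \sum_l T k i l x * X l x).

Let pdX k j x : partial k (X j) x = (G x *m cov_hess x) j k.
Proof.
rewrite (partial_inverse_image sf f0 sX HX) !mxE; apply: eq_bigr => i _.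
by rewrite mxE.
Qed.

Let HdX k i x : \sum_j H i j x * partial k (X j) x = cov_hess x i k.
Proof.
under eq_bigr => j _.
  rewrite pdX -hessE.
  over.
have := mulKVmx (hess_unit f0 x) (cov_hess x).
by move=> /matrixP/(_ i k) <-; rewrite mxE.
Qed.

(** [trace_inverse_image] yields the divergence of [X] and a [tau] term; [dV] trades [tau] plus the
    drift for the derivative of [V] and the constants [lin]. Derivatives of [L V] then involve only
    [X] and [V]. *)
Lemma laplacian_div x :
  L V x = \sum_j (partial j (X j) x + (partial j V x + lin j) * X j x).
Proof.
rewrite /weighted_laplacian (trace_inverse_image sf f0 sX HX).
rewrite -big_split /=; apply: eq_bigr => j _.
by rewrite dV /X; ring.
Qed.

Lemma innerE x : inner f V V x = \sum_j partial j V x * X j x.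
Proof.
apply: eq_bigr => i _; rewrite mulr_sumr; apply: eq_bigr => j _.
by rewrite !partialE; ring.
Qed.

Let c i x := \sum_a \sum_b T i a b x * X a x * X b x.

Let sc i : smooth (c i).
Proof.
apply: smooth_sum => a _; apply: smooth_sum => b _.
by apply: smoothM => //; apply: smoothM.
Qed.

Let DXX j x := \sum_k X k x * partial k (X j) x.

Let sDXX j : smooth (DXX j).
Proof. by apply: smooth_sum => k _; apply: smoothM => //;
  exact: smooth_partial. Qed.

Lemma cov_hess_tr x : (cov_hess x)^T = cov_hess x.
Proof.
apply/matrixP => i k; rewrite !mxE (partialC i k sV); congr (_ - _).
by apply: eq_bigr => l _; rewrite (third_swapl sf k i).
Qed.

Let cov_hess_sym x i k : cov_hess x i k = cov_hess x k i.
Proof. by rewrite -[in LHS]cov_hess_tr mxE. Qed.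

Lemma partial_inner_hess i x : partial i (inner f V V) x =
  \sum_k X k x * (cov_hess x i k + partial k (partial i V) x).
Proof.
have -> : inner f V V = fun x => \sum_j partial j V x * X j x.
  by apply/funext => y; exact: innerE.
rewrite (@partial_sum _ _ _ _ (fun j x => partial j V x * X j x)); last first.
  by move=> j; apply: differentiableM; exact: smooth_diff.
under eq_bigr do (rewrite partialM; [|exact: smooth_diff..]).
rewrite big_split /=.
have -> : \sum_j partial j V x * partial i (X j) x =
    \sum_k X k x * cov_hess x k i.
  under eq_bigr do rewrite -HX mulr_suml.
  rewrite exchange_big /=; apply: eq_bigr => k _; rewrite -HdX mulr_sumr.
  by apply: eq_bigr => j _; rewrite (partialC j k sf); ring.
rewrite -big_split /=; apply: eq_bigr => k _.
by rewrite (cov_hess_sym x k) (partialC i k sV); ring.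
Qed.

(** Splits the derivative of [Psi] into a part in the image of [hess f], to which
    [trace_inverse_image] applies, and the remainder [c = T(X, X)]. It rests on [hess V = S + T(X)]
    and [hess f dX = S]. *)
Lemma partial_inner i x : partial i (inner f V V) x =
  \sum_j H i j x * (2 * DXX j x) + c i x.
Proof.
have -> : \sum_j H i j x * (2 * DXX j x) = 2 * \sum_k X k x * cov_hess x i k.
  rewrite /DXX mulr_sumr; under eq_bigr do rewrite !mulr_sumr.
  rewrite exchange_big /=; apply: eq_bigr => k _; rewrite -HdX !mulr_sumr.
  by apply: eq_bigr => j _; ring.
have -> : c i x = \sum_k X k x * (partial k (partial i V) x - cov_hess x i k).
  apply: eq_bigr => a _; rewrite mxE subKr mulr_sumr; apply: eq_bigr => b _.
  by rewrite (third_swapl sf i a); ring.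
rewrite partial_inner_hess mulr_sumr -big_split /=; apply: eq_bigr => k _.
by ring.
Qed.

Lemma weighted_laplacian_inner x : L (inner f V V) x =
  2 * \sum_j (partial j (DXX j) x + (partial j V x + lin j) * DXX j x)
  + \sum_k \sum_i G x k i * partial k (c i) x
  + \sum_i w i x * \sum_j G x i j * c j x.
Proof.
pose q j x := 2 * DXX j x.
have sq j : smooth (q j) by apply: smoothM => //; exact: smooth_cst.
pose c' i y := \sum_j H i j y * q j y.
have sc' i : smooth (c' i) by apply: smooth_sum => j _; exact: smoothM.
have dP i : partial i (inner f V V) = fun y => c' i y + c i y.
  by apply/funext => y; rewrite partial_inner.
have Gc' i : \sum_j G x i j * c' j x = q i x.
  rewrite /c'; under eq_bigr do rewrite mulr_sumr.
  rewrite exchange_big /=.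
  under eq_bigr do (under eq_bigr do rewrite mulrA; rewrite -mulr_suml).
  have GH l : \sum_j G x i j * H j l x = (i == l)%:R.
    have /matrixP/(_ i l) := mulVmx (hess_unit f0 x).
    by rewrite !mxE => <-; apply: eq_bigr => k _; rewrite hessE.
  under eq_bigr do rewrite GH.
  rewrite (bigD1 i) //= eqxx mul1r big1 ?addr0 // => l li.
  by rewrite eq_sym (negPf li) mul0r.
rewrite /weighted_laplacian.
under eq_bigr do under eq_bigr do
  (rewrite dP partialD; [rewrite mulrDr|exact: smooth_diff..]).
under eq_bigr do rewrite big_split /=.
rewrite big_split /= (trace_inverse_image sf f0 sq (fun _ _ => erefl)).
under [X in _ + X = _]eq_bigr => i _.
  under eq_bigr do rewrite dP mulrDr.
  rewrite big_split /= Gc' mulrDr.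
  over.
rewrite 2!big_split /= addrA; congr (_ + _); rewrite addrAC; congr (_ + _).
rewrite -!big_split mulr_sumr /=; apply: eq_bigr => j _.
by rewrite dV /q partialZ; [ring|exact: smooth_diff].
Qed.

(** Product rule on both sides, with the second derivatives of [X] exchanged. Differentiating [L V]
    along [X] also differentiates the weight, which the left side does not; subtracting that
    contribution gives the last term, the Ricci term. *)
Lemma div_DXX x :
  \sum_j (partial j (DXX j) x + (partial j V x + lin j) * DXX j x) =
  \sum_k X k x * partial k (L V) x + \sum_j \sum_k partial j (X k) x * partial
    k (X j) x
  - \sum_k \sum_j X k x * X j x * partial k (partial j V) x.
Proof.
have dDXX j : partial j (DXX j) x = \sum_k (X k x * partial j (partial k (X j))
  x +
    partial k (X j) x * partial j (X k) x).
  rewrite (@partial_sum _ _ _ _ (fun k y => X k y * partial k (X j) y));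
    last first.
    by move=> k; apply: differentiableM;
      [exact: smooth_diff|exact/smooth_diff/smooth_partial].
  by apply: eq_bigr => k _; rewrite partialM //;
    [exact: smooth_diff|exact/smooth_diff/smooth_partial].
have dLV k : partial k (L V) x = \sum_j (partial k (partial j (X j)) x +
    ((partial j V x + lin j) * partial k (X j) x + X j x * partial k (partial j
      V) x)).
  rewrite (_ : L V = fun y =>
      \sum_j (partial j (X j) y + (partial j V y + lin j) * X j y)); last first.
    by apply/funext => y; exact: laplacian_div.
  rewrite (@partial_sum _ _ _ _ (fun j y => partial j (X j) y + (partial j V y
    + lin j) * X j y)).
    apply: eq_bigr => j _; rewrite partialD; first last.
    - apply: differentiableM; last exact: smooth_diff.
      by apply: differentiableD; [exact: smooth_diff|exact: differentiable_cst].
    - exact/smooth_diff/smooth_partial.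
    rewrite partialM; first last.
    - exact: smooth_diff.
    - by apply: differentiableD; [exact: smooth_diff|exact: differentiable_cst].
    rewrite partialD ?partial_cst ?addr0 //; last exact: smooth_diff.
  move=> j; apply: differentiableD; first exact/smooth_diff/smooth_partial.
  apply: differentiableM; last exact: smooth_diff.
  by apply: differentiableD; [exact: smooth_diff|exact: differentiable_cst].
under eq_bigr do rewrite dDXX /DXX mulr_sumr -big_split /=.
under [X in _ = X + _ - _]eq_bigr do rewrite dLV mulr_sumr.
rewrite exchange_big /= [X in _ = _ + X - _]exchange_big /=.
rewrite -big_split -sumrB /=; apply: eq_bigr => k _.
rewrite -big_split -sumrB /=; apply: eq_bigr => j _.
by rewrite (partialC j k (sX j)); ring.
Qed.

Let N b x : 'M[R]_n := \matrix_(i, j) T b i j x.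

Let HXm x : 'M[R]_n := \sum_b X b x *: N b x.

Let HXmE x i j : HXm x i j = \sum_b T b i j x * X b x.
Proof. by rewrite summxE; apply: eq_bigr => b _; rewrite !mxE mulrC. Qed.

Let cov_hessE x : cov_hess x = hess V x - HXm x.
Proof.
apply/matrixP => i j; rewrite [RHS]mxE [X in _ + X]mxE HXmE hessE mxE.
rewrite (partialC i j sV); congr (_ - _); apply: eq_bigr => l _.
by rewrite (third_swapl sf l i) (third_swapr sf i l) (third_swapl sf i j).
Qed.

Let tr_dXdX x : \sum_j \sum_k partial j (X k) x * partial k (X j) x =
  \tr (G x *m cov_hess x *m (G x *m cov_hess x)).
Proof.
rewrite exchange_big /mxtrace /=; apply: eq_bigr => k _; rewrite [RHS]mxE.
by apply: eq_bigr => j _; rewrite !pdX.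
Qed.

(** Differentiating [T] gives the fourth derivatives of the potential; each of the two factors [X]
    gives, through [dX = G S], one copy of the mixed trace. *)
Let tr_dc x : \sum_k \sum_i G x k i * partial k (c i) x =
  \sum_b \sum_a X b x * X a x *
    \sum_k \sum_i G x k i * partial b (T a k i) x
  + 2 * \tr (G x *m HXm x *m (G x *m cov_hess x)).
Proof.
have dc k i : partial k (c i) x =
    \sum_b \sum_a X b x * X a x * partial b (T a k i) x
    + 2 * (HXm x *m (G x *m cov_hess x)) i k.
  rewrite (@partial_sum _ _ _ _ (fun a x => \sum_b T i a b x * X a x * X b x));
    last first.
    move=> a; apply: differentiable_sumf => b.
    by apply: smooth_diff; apply: smoothM => //; apply: smoothM.
  under eq_bigr => a _.
    rewrite (@partial_sum _ _ _ _ (fun b x => T i a b x * X a x * X b x));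
      last first.
      move=> b; apply: smooth_diff; apply: smoothM => //; exact: smoothM.
    under eq_bigr => b _.
      rewrite partialM; [|apply: smooth_diff;
        exact: smoothM|exact: smooth_diff].
      rewrite partialM; [|exact: smooth_diff..].
      rewrite (_ : _ + _ = X a x * X b x * partial a (T b k i) x +
        (T b i a x * X b x * partial k (X a) x +
         T a i b x * X a x * partial k (X b) x)); last first.
        rewrite (_ : T b i a = T i a b); last first.
          by rewrite (third_swapl sf b i) (third_swapr sf i b).
        rewrite (_ : T a i b = T i a b); last by rewrite (third_swapl sf a i).
        rewrite (_ : partial a (T b k i) = partial k (T i a b)); last first.
          rewrite (third_swapl sf b k) (third_swapr sf k b).
          rewrite (partialC a k (smooth_partial _ (smooth_partial _ sf))).
          by rewrite (third_swapl sf a i) (third_swapr sf i a).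
        by ring.
      over.
    rewrite big_split /=; over.
  rewrite big_split /=; congr (_ + _).
  under eq_bigr do rewrite big_split /=.
  rewrite big_split /= [X in _ + X]exchange_big /= -mulr2n mulr_natl.
  congr (_ *+ 2); rewrite mxE; apply: eq_bigr => a _.
  by rewrite HXmE mulr_suml pdX.
under eq_bigr do under eq_bigr do rewrite dc mulrDr.
under eq_bigr do rewrite big_split /=.
rewrite big_split /=; congr (_ + _).
  under eq_bigr do under eq_bigr do rewrite mulr_sumr.
  under eq_bigr do rewrite exchange_big /=.
  rewrite exchange_big /=; apply: eq_bigr => b _.
  under eq_bigr do under eq_bigr do rewrite mulr_sumr.
  under eq_bigr do rewrite exchange_big /=.
  rewrite exchange_big /=; apply: eq_bigr => a _.
  rewrite [RHS]mulr_sumr; apply: eq_bigr => k _.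
  by rewrite [RHS]mulr_sumr; apply: eq_bigr => i _; rewrite mulrCA.
rewrite -mulmxA /mxtrace mulr_sumr; apply: eq_bigr => k _.
by rewrite [in RHS]mxE mulr_sumr; apply: eq_bigr => i _; rewrite mulrCA.
Qed.

(** Second derivatives of log det (hess f) along [X]: the same fourth-order sum as in [tr_dc], and a
    trace from differentiating the inverse Hessian. Together with [dV] this eliminates the fourth
    derivatives. *)
Let tr_dtau x : \sum_b \sum_a X b x * X a x * partial b (fun y => tau a y) x =
  \sum_b \sum_a X b x * X a x *
    \sum_k \sum_i G x k i * partial b (T a k i) x
  - \tr (G x *m HXm x *m (G x *m HXm x)).
Proof.
have dtau b a : partial b (fun y => tau a y) x =
    \sum_k \sum_i G x k i * partial b (T a k i) x
    - \tr (G x *m N b x *m (G x *m N a x)).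
  rewrite (@partial_sum _ _ _ _ (fun k y => \sum_i G y k i * T a k i y));
    last first.
    move=> k; apply: differentiable_sumf => i; apply: smooth_diff.
    by apply: smoothM => //; exact: smooth_inv_hess.
  rewrite /mxtrace -sumrB; apply: eq_bigr => k _.
  rewrite (@partial_sum _ _ _ _ (fun i y => G y k i * T a k i y)); last first.
    move=> i; apply: smooth_diff.
    by apply: smoothM => //; exact: smooth_inv_hess.
  rewrite mulmxA mxE -sumrB; apply: eq_bigr => i _.
  rewrite partialM; [|apply: smooth_diff;
    exact: smooth_inv_hess|exact: smooth_diff].
  congr (_ + _); rewrite (partial_inv_hess sf f0) mulrN mulrC; congr (- _).
  rewrite [N a x _ _]mxE (third_swapr sf a i); congr (_ * _).
  rewrite mxE exchange_big /=; apply: eq_bigr => e _.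
  rewrite mxE mulr_suml; apply: eq_bigr => l _.
  by rewrite mxE.
under eq_bigr do under eq_bigr do rewrite dtau mulrBr.
under eq_bigr do rewrite sumrB.
rewrite sumrB; congr (_ - _).
rewrite {1}/HXm mulmx_sumr mulmx_suml raddf_sum /=; apply: eq_bigr => b _.
rewrite /HXm !mulmx_sumr raddf_sum /=; apply: eq_bigr => a _.
by rewrite -!scalemxAr -!scalemxAl !linearZ /= [RHS]mulrCA mulrA.
Qed.


Let dw b a x : partial b (w a) x =
  \sum_e ((D e x)^-1 * (\sum_i C e i * T b a i x)
    - (D e x)^-1 * partial b (D e) x * ((D e x)^-1 * partial a (D e) x)).
Proof.
rewrite (@partial_sum _ _ _ _ (fun e x => (D e x)^-1 * partial a (D e) x));
  last first.
  move=> e; apply: smooth_diff; apply: smoothM; last exact: smooth_partial.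
  exact: smoothV.
apply: eq_bigr => e _; rewrite partialM; last first.
- exact/smooth_diff/smooth_partial.
- exact/smooth_diff/smoothV.
rewrite partialV //; last exact: smooth_diff.
have dDe a' : partial a' (D e) = fun y => \sum_i C e i * H a' i y.
  apply/funext => y; rewrite DE.
  rewrite (@partial_sum _ _ _ _ (fun i x => C e i * partial i f x)); last first.
    by move=> i; apply: smooth_diff; apply: smoothM;
      [exact: smooth_cst|exact: smooth_partial].
  by apply: eq_bigr => i _; rewrite partialZ //;
    exact/smooth_diff/smooth_partial.
rewrite {1}dDe (@partial_sum _ _ _ _ (fun i y => C e i * H a i y)); last first.
  by move=> i; apply: smooth_diff; apply: smoothM => //; exact: smooth_cst.
congr (_ * _ + _).
  by apply: eq_bigr => i _; rewrite partialZ //; exact: smooth_diff.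
by rewrite expr2 invfM; ring.
Qed.

(** [D e] is linear in the first derivatives of [f], so its gradient is the constant vector [C e]:
    [hess f] and its inverse cancel. *)
Let w_c x : \sum_i w i x * \sum_j G x i j * c j x =
  \sum_e (D e x)^-1 * \sum_b \sum_a X b x * X a x * \sum_i C e i * T b a i x.
Proof.
have wG j : \sum_i w i x * G x i j = \sum_e (D e x)^-1 * C e j.
  rewrite /dlog_weight; under eq_bigr do rewrite mulr_suml.
  rewrite exchange_big /=; apply: eq_bigr => e _.
  under eq_bigr do rewrite -mulrA; rewrite -mulr_sumr; congr (_ * _).
  under eq_bigr => i _.
    rewrite DE (@partial_sum _ _ _ _ (fun l x => C e l * partial l f x));
      last first.
      by move=> l; apply: smooth_diff; apply: smoothM;
        [exact: smooth_cst|exact: smooth_partial].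
    under eq_bigr => l _.
      rewrite partialZ; last exact/smooth_diff/smooth_partial.
      rewrite (partialC i l sf); over.
    rewrite mulr_suml; over.
  rewrite exchange_big /=.
  under eq_bigr do (under eq_bigr do rewrite -mulrA; rewrite -mulr_sumr HG).
  rewrite (bigD1 j) //= eqxx mulr1 big1 ?addr0 // => l lj.
  by rewrite (negPf lj) mulr0.
under eq_bigr do (rewrite mulr_sumr; under eq_bigr do rewrite mulrA).
rewrite exchange_big /=.
under eq_bigr do (rewrite -mulr_suml wG mulr_suml).
rewrite exchange_big /=; apply: eq_bigr => e _.
under eq_bigr do rewrite -mulrA; rewrite -mulr_sumr; congr (_ * _).
rewrite /c /=; under eq_bigr do (rewrite mulr_sumr;
  under eq_bigr do rewrite mulr_sumr).
rewrite exchange_big /=; apply: eq_bigr => b _.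
rewrite exchange_big /=; apply: eq_bigr => a _.
rewrite [RHS]mulr_sumr; apply: eq_bigr => i _.
rewrite (third_swapl sf i b) (third_swapr sf b i).
by move: (X b x) (X a x) (C e i) (T b a i x) => ? ? ? ?; ring.
Qed.

(** The first trace is [|S|^2]; the second one together with the final sum over the roots is
    [|V_{,A Bbar}|^2]. *)
Lemma bochner x : L (inner f V V) x =
  2 * \sum_k X k x * partial k (L V) x
  + \tr (G x *m cov_hess x *m (G x *m cov_hess x))
  + \tr (G x *m hess V x *m (G x *m hess V x))
  - \sum_k \sum_j X k x * X j x * partial k (partial j V) x
  + \sum_e ((D e x)^-1 * \sum_b X b x * partial b (D e) x) ^+ 2.
Proof.
have dp b a : partial b (fun y => tau a y) x =
    partial b (partial a V) x - partial b (w a) x.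
  rewrite (_ : (fun y => tau a y) = fun y => partial a V y + lin a - w a y).
    rewrite partialB; [|apply: differentiableD|exact: smooth_diff].
    - rewrite partialD ?partial_cst ?addr0 //; exact: smooth_diff.
    - exact: smooth_diff.
    - exact: differentiable_cst.
  by apply/funext => y; rewrite dV; ring.
(* The third derivatives of [f] inside the second derivatives of [D e] match the drift applied to
   [c]; what survives are the squares, the root part of [|V_{,A Bbar}|^2]. *)
have XXw : \sum_b \sum_a X b x * X a x * partial b (w a) x =
    \sum_i w i x * \sum_j G x i j * c j x
    - \sum_e ((D e x)^-1 * \sum_b X b x * partial b (D e) x) ^+ 2.
  rewrite w_c -sumrB.
  under eq_bigr do under eq_bigr do rewrite dw mulr_sumr.
  under eq_bigr do rewrite exchange_big /=.
  rewrite exchange_big /=; apply: eq_bigr => e _.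
  under eq_bigr do under eq_bigr do rewrite mulrBr.
  under eq_bigr do rewrite sumrB; rewrite sumrB; congr (_ - _).
    rewrite mulr_sumr; apply: eq_bigr => b _; rewrite mulr_sumr.
    by apply: eq_bigr => a _; rewrite mulrCA.
  rewrite expr2 {1}mulr_sumr mulr_suml; apply: eq_bigr => b _.
  rewrite !mulr_sumr; apply: eq_bigr => a _.
  move: (X b x) (X a x) (partial b _ x) (partial a _ x) => ? ? ? ?; ring.
have := tr_dtau x.
under eq_bigr do under eq_bigr do rewrite dp mulrBr.
under eq_bigr do rewrite sumrB.
rewrite sumrB XXw => tauE.
rewrite weighted_laplacian_inner div_DXX tr_dXdX tr_dc.
set t1 := \tr (G x *m cov_hess x *m (G x *m cov_hess x)) in tauE *.
set t2 := \tr (G x *m HXm x *m (G x *m cov_hess x)) in tauE *.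
set t3 := \tr (G x *m HXm x *m (G x *m HXm x)) in tauE *.
(* Expansion of [hess V = S + T(X)]: [2 * t2] is supplied by [tr_dc] and [t3] by [tr_dtau]. *)
have -> : \tr (G x *m hess V x *m (G x *m hess V x)) = t1 + 2 * t2 + t3.
  rewrite (_ : hess V x = cov_hess x + HXm x); last by rewrite cov_hessE subrK.
  rewrite !mulmxDr !mulmxDl !raddfD /= -/t1 -/t2 -/t3.
  rewrite (_ : \tr (G x *m cov_hess x *m (G x *m HXm x)) = t2).
    by rewrite mulr_natl mulr2n; ring.
  by rewrite mxtrace_mulC.
move: tauE.
set qq := \sum_b \sum_a X b x * X a x * \sum_k \sum_i _.
set wc := \sum_i w i x * _.
set xx := \sum_e _ ^+ 2.
set kk := \sum_k \sum_j _ * _ * partial k _ x.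
set ll := \sum_k X k x * _.
by move=> e; rewrite (_ : qq = kk - (wc - xx) + t3); [ring|rewrite e subrK].
Qed.

End bochner.

(** * Positive semidefinite matrices and completed squares *)

Lemma psd_factor (R : rcfType) (n : nat) (H : 'M[R]_n) : H^T = H ->
  (forall y : 'rV_n, 0 <= (y *m H *m y^T) 0 0) -> exists B : 'M[R]_n, H = B^T
    *m B.
Proof.
elim: n H => [|n IH] H.
  by move=> _ _; exists 0; apply/matrixP => -[].
rewrite -[n.+1]/(1 + n)%N in H *.
rewrite -[H]submxK; set a := ulsubmx H; set b := ursubmx H.
set b' := dlsubmx H; set C := drsubmx H.
rewrite tr_block_mx => /eq_block_mx[_ _ bb' CT].
rewrite -{}bb' {b'}.
have [al al_eq] : exists al, a = al%:M.
  by exists (a 0 0); rewrite [LHS]mx11_scalar.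
rewrite {}al_eq {a} => psd; clearbody b C.
have addE (A A' : 'M[R]_1) : (A + A') 0 0 = A 0 0 + A' 0 0 by rewrite mxE.
have trE (A : 'M[R]_1) : A^T 0 0 = A 0 0 by rewrite mxE.
have quad t (y : 'rV_n) : 0 <= t ^+ 2 * al + 2 * t * (b *m y^T) 0 0
    + (y *m C *m y^T) 0 0.
  have := psd (row_mx t%:M y).
  rewrite mul_row_block tr_row_mx mul_row_col !mulmxDl !addE.
  have -> : (y *m b^T *m t%:M^T) 0 0 = t * (b *m y^T) 0 0.
    rewrite tr_scalar_mx mul_mx_scalar mxE; congr (_ * _).
    by rewrite -[LHS]trE trmx_mul trmxK.
  have -> : (t%:M *m b *m y^T) 0 0 = t * (b *m y^T) 0 0.
    by rewrite mul_scalar_mx -scalemxAl mxE.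
  rewrite (_ : (t%:M *m al%:M *m t%:M^T) 0 0 = t ^+ 2 * al); last first.
    by rewrite tr_scalar_mx -!scalar_mxM mxE mulr1n mulrAC expr2.
  by move=> h; apply: (le_trans h); rewrite le_eqVlt; apply/orP; left;
    apply/eqP; ring.
have al0 : 0 <= al by have := quad 1 0; rewrite !(trmx0, mulmx0, mul0mx) mxE;
  lra.
(* Cholesky step: the Schur complement is positive semidefinite, seen at the [t] that minimizes the
   form. Division by 0 being 0, for [al = 0] the same instance reads [t = 0] and the complement is
   [C]. *)
have [B HB] : exists B : 'M[R]_n, C - al^-1 *: (b^T *m b) = B^T *m B.
  apply: IH.
    rewrite linearB /= linearZ /= trmx_mul trmxK; congr (_ - _).
    exact: CT.
  move=> y; have := quad (- (b *m y^T) 0 0 / al) y.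
  have -> : (y *m (C - al^-1 *: (b^T *m b)) *m y^T) 0 0 =
      (y *m C *m y^T) 0 0 - al^-1 * (b *m y^T) 0 0 ^+ 2.
    rewrite mulmxBr mulmxBl mxE [X in _ + X]mxE; congr (_ - _).
    rewrite -scalemxAr -scalemxAl mxE; congr (_ * _).
    rewrite -!mulmxA mulmxA mxE big_ord1 expr2; congr (_ * _).
    by rewrite -[LHS]trE trmx_mul trmxK.
  have [->|aln0] := eqVneq al 0; first by rewrite invr0; lra.
  move=> h; apply: (le_trans h); rewrite le_eqVlt; apply/orP; left; apply/eqP.
  by field.
have [al_eq0|aln0] := eqVneq al 0.
  have b0 : b = 0.
    apply/rowP => j; rewrite [RHS]mxE; case: (eqVneq (b 0 j) 0) => [//|bj];
      exfalso.
    pose y : 'rV[R]_n := delta_mx 0 j.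
    have by' : (b *m y^T) 0 0 = b 0 j.
      rewrite mxE (bigD1 j) //= !mxE !eqxx mulr1 big1 ?addr0 // => i ij.
      by rewrite !mxE (negPf ij) andbF mulr0.
    (* For [al = 0] the form is affine in [t]; this [t] would give it the value [-1]. *)
    have := quad (- ((y *m C *m y^T) 0 0 + 1) / (2 * b 0 j)) y.
    rewrite by' al_eq0 mulr0 add0r.
    rewrite (_ : 2 * _ * _ = - ((y *m C *m y^T) 0 0 + 1)); last by field;
      exact/bj.
    by lra.
  exists (block_mx 0 0 0 B).
  rewrite tr_block_mx mulmx_block !(trmx0, mulmx0, mul0mx, add0r, addr0).
  by rewrite -HB b0 !(trmx0, mulmx0, mul0mx, scaler0, subr0) al_eq0 raddf0.
have sal : Num.sqrt al != 0 by rewrite gt_eqF // sqrtr_gt0 lt0r aln0.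
exists (block_mx (Num.sqrt al)%:M ((Num.sqrt al)^-1 *: b) 0 B).
rewrite tr_block_mx mulmx_block !(trmx0, mulmx0, mul0mx, add0r, addr0).
rewrite tr_scalar_mx -scalar_mxM -expr2 sqr_sqrtr // mul_scalar_mx.
rewrite scalerA mulfV // scale1r linearZ /= -scalemxAl mul_mx_scalar scalerA.
rewrite mulVf // scale1r -scalemxAl -scalemxAr scalerA -invfM -expr2.
by rewrite sqr_sqrtr // -HB addrC subrK.
Qed.

(** The trace is the squared Frobenius norm of the symmetric matrix [B S B^T]. *)
Lemma trace_sqr_ge0 (R : realDomainType) (n : nat) (B S : 'M[R]_n) : S^T = S ->
  0 <= \tr (B^T *m B *m S *m (B^T *m B *m S)).
Proof.
move=> ST; pose W := B *m S *m B^T.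
have WT : W^T = W by rewrite /W !trmx_mul trmxK ST mulmxA.
have -> : \tr (B^T *m B *m S *m (B^T *m B *m S)) = \tr (W *m W).
  by rewrite /W -!mulmxA mxtrace_mulC !mulmxA.
apply: sumr_ge0 => i _; rewrite mxE; apply: sumr_ge0 => j _.
have -> : W j i = W i j by rewrite -[in LHS]WT [LHS]mxE.
by rewrite -expr2 sqr_ge0.
Qed.

(** [trace_sqr_ge0] for the rank one perturbation [S + la r^T r], expanded. Both completed squares
    of the main estimate are instances. *)
Lemma trace_rank1_ge0 (R : realFieldType) (n : nat) (B S : 'M[R]_n)
    (r : 'rV[R]_n) (la : R) (G := B^T *m B) (X := r *m G) : S^T = S ->
  0 <= \tr (G *m S *m (G *m S)) + 2 * la * (\sum_i \sum_j X 0 i * X 0 j * S i j)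
       + la ^+ 2 * (\sum_i r 0 i * X 0 i) ^+ 2.
Proof.
move=> ST; pose W := S + la *: (r^T *m r).
have WT : W^T = W.
  by rewrite /W linearD linearZ /= ST trmx_mul trmxK.
have GT : G^T = G by rewrite /G trmx_mul trmxK.
have := trace_sqr_ge0 B WT; rewrite -/G.
have e1 : (X *m S *m X^T) 0 0 = \sum_i \sum_j X 0 i * X 0 j * S i j.
  rewrite mxE exchange_big /=; apply: eq_bigr => j _.
  rewrite [(X *m S) _ _]mxE [X^T _ _]mxE mulr_suml.
  by apply: eq_bigr => i _; rewrite mulrAC.
have e2 : (r *m X^T) 0 0 = \sum_i r 0 i * X 0 i.
  by rewrite mxE; apply: eq_bigr => i _; rewrite [X^T _ _]mxE.
have e2' : (X *m r^T) 0 0 = \sum_i r 0 i * X 0 i.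
  by rewrite mxE; apply: eq_bigr => i _; rewrite [r^T _ _]mxE mulrC.
have XT : X^T = G *m r^T by rewrite /X trmx_mul GT.
have tr11 (M : 'M[R]_1) : \tr M = M 0 0 by rewrite /mxtrace big_ord1.
have t1 : \tr (G *m S *m (G *m (r^T *m r))) = (X *m S *m X^T) 0 0.
  by rewrite !mulmxA mxtrace_mulC tr11 XT /X !mulmxA.
have t2 : \tr (G *m (r^T *m r) *m (G *m (r^T *m r))) =
    (\sum_i r 0 i * X 0 i) ^+ 2.
  have -> : \tr (G *m (r^T *m r) *m (G *m (r^T *m r))) =
      \tr ((X *m r^T) *m (X *m r^T)).
    by rewrite !mulmxA mxtrace_mulC /X !mulmxA.
  by rewrite tr11 mxE big_ord1 e2' expr2.
rewrite /W mulmxDr -scalemxAr !mulmxDl !mulmxDr !raddfD /=.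
rewrite -!scalemxAr -!scalemxAl !linearZ /= t1 t2.
rewrite (mxtrace_mulC (G *m (r^T *m r))) t1 e1.
move=> h; apply: (le_trans h); rewrite le_eqVlt; apply/orP; left; apply/eqP.
by ring.
Qed.

(** * The inequality on the open orbit *)

Section invariant_operators.
Variables (R : realType) (n m : nat) (f : 'rV[R]_n -> R).
Variable D : 'I_m -> 'rV[R]_n -> R.
Variable x : 'rV[R]_n.
Hypothesis f0 : \det (hess f x) != 0.
Hypothesis D0 : forall a, D a x != 0.

Local Notation G := (invmx (hess f x)).

Definition dlog_deriv (F : 'rV[R]_n -> R) (a : 'I_m) : R :=
  (D a x)^-1 * \sum_k (\sum_l G k l * partial l F x) * partial k (D a) x.

(** The factors 1/4 of the frame normalization cancel here once and for all; the Laplacian and the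
    norm of the complex Hessian become the traces of this block matrix and of its square. *)
Lemma inv_metric_chess (F : 'rV[R]_n -> R) :
  invmx (metric f D x) *m chess f D F x =
  block_mx (G *m hess F x) 0 0 (diag_mx (\row_a dlog_deriv F a)).
Proof.
have uH : hess f x \in unitmx by rewrite unitmxE unitfE.
pose M : 'M[R]_(n + m) := block_mx (4 *: G) 0 0 (diag_mx (\row_a (4 / D a x))).
have eM : metric f D x *m M = 1%:M.
  rewrite /metric mulmx_block !(mulmx0, mul0mx, addr0, add0r) mulmx_diag.
  rewrite -scalemxAr -scalemxAl scalerA mulmxV // mulfV // scale1r.
  rewrite [RHS]scalar_mx_block; congr (block_mx _ _ _ _).
  rewrite -diag_const_mx; congr diag_mx; apply/rowP => a; rewrite !mxE.
  by field.
have uM := mulmx1_unit eM; rewrite (_ : invmx _ = M); last first.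
  by rewrite -[LHS]mulmx1 -eM mulKmx //; case: uM.
rewrite /M /chess mulmx_block !(mulmx0, mul0mx, addr0, add0r) mulmx_diag.
rewrite -scalemxAr -scalemxAl scalerA mulVf // scale1r.
congr (block_mx _ _ _ (diag_mx _)); apply/rowP => a; rewrite !mxE /dlog_deriv.
rewrite mulrA (_ : 4 / D a x * 4^-1 = (D a x)^-1); last by field.
congr (_ * _); apply: eq_bigr => k _.
rewrite mulr_suml; apply: eq_bigr => l _.
by rewrite !partialE; ring.
Qed.

Lemma chess_tr (F : 'rV[R]_n -> R) : smooth F ->
  (chess f D F x)^T = chess f D F x.
Proof.
move=> sF; rewrite /chess tr_block_mx !trmx0 linearZ /= hess_tr //.
by rewrite tr_diag_mx.
Qed.

Lemma chess_sym (F : 'rV[R]_n -> R) A B : smooth F ->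
  chess f D F x A B = chess f D F x B A.
Proof. by move=> sF; rewrite -[in LHS](chess_tr sF) [LHS]mxE. Qed.

Lemma laplacian_weighted (F : 'rV[R]_n -> R) : smooth F ->
  laplacian f D F x = weighted_laplacian f D F x.
Proof.
move=> sF; transitivity (\tr (invmx (metric f D x) *m chess f D F x)).
  rewrite /mxtrace; apply: eq_bigr => A _; rewrite mxE; apply: eq_bigr => B _.
  by congr (_ * _); exact: chess_sym.
rewrite inv_metric_chess mxtrace_block; congr (_ + _).
  apply: eq_bigr => i _; rewrite mxE; apply: eq_bigr => j _.
  by rewrite hessE partialC_pt.
rewrite mxtrace_diag; under eq_bigr do rewrite mxE /dlog_deriv.
rewrite /dlog_weight; under [RHS]eq_bigr do rewrite mulr_suml.
rewrite [RHS]exchange_big /=; apply: eq_bigr => a _.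
rewrite mulr_sumr; apply: eq_bigr => k _.
by rewrite -mulrA; congr (_ * _); exact: mulrC.
Qed.

Lemma chess_norm2E (F : 'rV[R]_n -> R) : smooth F ->
  chess_norm2 f D F x =
  \tr (G *m hess F x *m (G *m hess F x)) + \sum_a dlog_deriv F a ^+ 2.
Proof.
move=> sF.
have <- : \tr (invmx (metric f D x) *m chess f D F x *m
    (invmx (metric f D x) *m chess f D F x)) =
  \tr (G *m hess F x *m (G *m hess F x)) + \sum_a dlog_deriv F a ^+ 2.
  rewrite inv_metric_chess mulmx_block !(mulmx0, mul0mx, addr0, add0r).
  rewrite mulmx_diag mxtrace_block mxtrace_diag; congr (_ + _).
  by apply: eq_bigr => a _; rewrite !mxE expr2.
rewrite /chess_norm2 /mxtrace; apply: eq_bigr => A _.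
rewrite mxE exchange_big /=; apply: eq_bigr => C _.
rewrite [(invmx _ *m chess _ _ _ _) A C]mxE mulr_suml; apply: eq_bigr => B _.
rewrite [(invmx _ *m chess _ _ _ _) C A]mxE mulr_sumr; apply: eq_bigr => E _.
rewrite (chess_sym A E sF) (chess_sym C B sF).
by move: (invmx _) (chess _ _ _ _) => ? ?; ring.
Qed.

End invariant_operators.

Section chain_rules.
Variables (R : realType) (n m : nat) (f : 'rV[R]_n -> R).
Variable D : 'I_m -> 'rV[R]_n -> R.
Hypothesis sf : smooth f.
Implicit Types (F h : 'rV[R]_n -> R) (x : 'rV[R]_n).

Local Notation G x := (invmx (hess f x)).
Local Notation L := (weighted_laplacian f D).

Lemma innerE_partial F h x :
  inner f F h x = \sum_i \sum_j G x i j * partial i F x * partial j h x.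
Proof.
by apply: eq_bigr => i _; apply: eq_bigr => j _; rewrite !partialE.
Qed.

Lemma inner_sym F h x : inner f F h x = inner f h F x.
Proof.
rewrite !innerE_partial exchange_big /=; apply: eq_bigr => i _.
by apply: eq_bigr => j _; rewrite (inv_hess_sym sf); ring.
Qed.

(** Stated through derivatives at a single point because the factor, such as [phi] below, depends on
    the point. *)
Lemma inner_scalel (c : R) F F' h x :
  (forall i, partial i F' x = c * partial i F x) ->
  inner f F' h x = c * inner f F h x.
Proof.
move=> dF; rewrite !innerE_partial mulr_sumr; apply: eq_bigr => i _.
by rewrite mulr_sumr; apply: eq_bigr => j _; rewrite dF; ring.
Qed.

Lemma inner_scaler (c : R) F h h' x :
  (forall i, partial i h' x = c * partial i h x) ->
  inner f F h' x = c * inner f F h x.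
Proof. by move=> dh; rewrite inner_sym (inner_scalel _ dh) inner_sym. Qed.

Lemma weighted_laplacian_lincomb (c d : R) F h x : smooth F -> smooth h ->
  L (fun y => c * F y + d * h y) x = c * L F x + d * L h x.
Proof.
move=> sF sh; have dL i : partial i (fun y => c * F y + d * h y) =
    fun y => c * partial i F y + d * partial i h y.
  apply/funext => y; rewrite partialD ?partialZ //; try exact: smooth_diff.
  - by apply/smooth_diff/smoothM => //; exact: smooth_cst.
  - by apply/smooth_diff/smoothM => //; exact: smooth_cst.
have ddL i j : partial i (partial j (fun y => c * F y + d * h y)) x =
    c * partial i (partial j F) x + d * partial i (partial j h) x.
  rewrite dL partialD ?partialZ //; try exact/smooth_diff/smooth_partial.
  - by apply/smooth_diff/smoothM; [exact: smooth_cst|exact: smooth_partial].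
  - by apply/smooth_diff/smoothM; [exact: smooth_cst|exact: smooth_partial].
rewrite /weighted_laplacian !mulrDr addrACA.
congr (_ + _); rewrite !mulr_sumr -!big_split /=; apply: eq_bigr => i _.
  rewrite !mulr_sumr -!big_split /=; apply: eq_bigr => j _.
  by rewrite ddL; ring.
rewrite !mulr_sumr -!big_split /=; apply: eq_bigr => j _.
by rewrite dL; ring.
Qed.

Lemma weighted_laplacianM F h x : smooth F -> smooth h ->
  L (fun y => F y * h y) x = F x * L h x + h x * L F x + 2 * inner f F h x.
Proof.
move=> sF sh; have dL i : partial i (fun y => F y * h y) =
    fun y => F y * partial i h y + h y * partial i F y.
  by apply/funext => y; rewrite partialM //; exact: smooth_diff.
have ddL i j : partial i (partial j (fun y => F y * h y)) x =
    F x * partial i (partial j h) x + h x * partial i (partial j F) x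
    + (partial j h x * partial i F x + partial j F x * partial i h x).
  rewrite dL partialD ?partialM //; try exact: smooth_diff;
    try exact/smooth_diff/smooth_partial.
  - by ring.
  - by apply/smooth_diff/smoothM => //; exact: smooth_partial.
  - by apply/smooth_diff/smoothM => //; exact: smooth_partial.
have -> : 2 * inner f F h x = \sum_i \sum_j G x i j *
    (partial j h x * partial i F x + partial j F x * partial i h x).
  rewrite mulr_natl mulr2n {1}inner_sym !innerE_partial -!big_split /=.
  apply: eq_bigr => i _; rewrite -!big_split /=; apply: eq_bigr => j _.
  by ring.
rewrite /weighted_laplacian !mulrDr [X in _ = X + _]addrACA [RHS]addrAC.
congr (_ + _); rewrite !mulr_sumr -!big_split /=; apply: eq_bigr => i _.
  rewrite !mulr_sumr -!big_split /=; apply: eq_bigr => j _.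
  by rewrite ddL; ring.
rewrite !mulr_sumr -!big_split /=; apply: eq_bigr => j _.
by rewrite dL; ring.
Qed.

Lemma weighted_laplacian_expR F x : smooth F ->
  L (fun y => expR (F y)) x = expR (F x) * (L F x + inner f F F x).
Proof.
move=> sF; have dL i : partial i (fun y => expR (F y)) =
    fun y => expR (F y) * partial i F y.
  by apply/funext => y; rewrite partial_expR //; exact: smooth_diff.
have ddL i j : partial i (partial j (fun y => expR (F y))) x =
    expR (F x) * (partial i (partial j F) x + partial i F x * partial j F x).
  rewrite dL partialM ?partial_expR //; try exact: smooth_diff.
  - by ring.
  - exact/smooth_diff/smooth_expR.
  - exact/smooth_diff/smooth_partial.
rewrite innerE_partial /weighted_laplacian addrAC mulrDr.
congr (_ + _).
  rewrite -big_split mulr_sumr /=; apply: eq_bigr => i _.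
  rewrite -big_split mulr_sumr /=; apply: eq_bigr => j _.
  by rewrite ddL; ring.
rewrite mulr_sumr; apply: eq_bigr => i _.
rewrite !mulr_sumr; apply: eq_bigr => j _.
by rewrite dL; ring.
Qed.

End chain_rules.

Section interior.
Variables (R : realType) (n m : nat) (f F : 'rV[R]_n -> R).
Variables (C : 'I_m -> 'I_n -> R) (D : 'I_m -> 'rV[R]_n -> R) (lin : 'I_n -> R).
Hypotheses (sf : smooth f) (sF : smooth F) (F0 : forall x, 0 < F x).
Hypothesis f0 : forall x, \det (hess f x) != 0.
Hypothesis DE : forall a, D a = fun x => \sum_i C a i * partial i f x.
Hypothesis D0 : forall a x, D a x != 0.
Hypothesis psd : forall x (y : 'rV[R]_n), 0 <= (y *m hess f x *m y^T) 0 0.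

Let V x := ln (F x).
Let Psi := inner f V V.

Hypothesis dV : forall j x, partial j V x =
  \sum_k \sum_i invmx (hess f x) k i * partial j (partial k (partial i f)) x
  + dlog_weight D j x - lin j.

Local Notation G x := (invmx (hess f x)).
Local Notation L := (weighted_laplacian f D).

Let sV : smooth V. Proof. exact: smooth_ln. Qed.

Lemma inv_hess_factor x : exists B : 'M[R]_n, G x = B^T *m B.
Proof.
have uH := hess_unit f0 x.
have [B HB] := psd_factor (hess_tr x sf) (psd x).
have uB : B \in unitmx by move: uH; rewrite HB unitmx_mul => /andP[].
exists (invmx B)^T; rewrite trmxK HB.
have uBT : B^T \in unitmx by rewrite unitmx_tr.
rewrite -[RHS]mulmx1 -(mulmxV (_ : B^T *m B \in unitmx)); last first.
  by rewrite unitmx_mul uB uBT.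
rewrite trmx_inv !mulmxA -[invmx B *m _ *m _]mulmxA mulVmx // mulmx1.
by rewrite mulVmx // mul1mx.
Qed.

Let smooth_Psi : smooth Psi.
Proof.
rewrite (_ : Psi = fun x => \sum_j partial j V x * gradient f V j x).
  apply: smooth_sum => j _; apply: smoothM; first exact: smooth_partial.
  apply: smooth_sum => i _; apply: smoothM; last exact: smooth_partial.
  exact: smooth_inv_hess.
by apply/funext => y; exact: innerE.
Qed.

Let smooth_LV : smooth (L V).
Proof.
apply: smoothD.
  apply: smooth_sum => i _; apply: smooth_sum => j _; apply: smoothM.
    exact: smooth_inv_hess.
  exact/smooth_partial/smooth_partial.
apply: smooth_sum => i _; apply: smoothM.
  apply: smooth_sum => a _; apply: smoothM.
    apply: smoothV => //; rewrite DE; apply: smooth_sum => l _; apply: smoothM.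
      exact: smooth_cst.
    exact: smooth_partial.
  apply: smooth_partial; rewrite DE; apply: smooth_sum => l _; apply: smoothM.
    exact: smooth_cst.
  exact: smooth_partial.
apply: smooth_sum => j _; apply: smoothM; first exact: smooth_inv_hess.
exact: smooth_partial.
Qed.

Lemma inner_gradient (h : 'rV[R]_n -> R) x :
  inner f h V x = \sum_k gradient f V k x * partial k h x.
Proof.
rewrite innerE_partial; apply: eq_bigr => i _; rewrite mulr_suml.
by apply: eq_bigr => j _; ring.
Qed.

Lemma interior_inequality (a kappa : R) x :
  let AA := fun x => - laplacian f D V x in
  let P := fun x => expR (kappa * F x `^ a) * Num.sqrt (F x) * Psi x in
  Psi x != 0 ->
  laplacian f D P x / P x >=
    chess_norm2 f D V x / (2 * Psi x)
    + a ^+ 2 * kappa * (1 - 2 * kappa * F x `^ a) * F x `^ a * Psi x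
    - 2 * `|inner f AA V x| / Psi x
    - (a * kappa * F x `^ a + 2^-1) * AA x.
Proof.
move=> AA P Psi0.
have powF y : F y `^ a = expR (a * V y) by rewrite /powR gt_eqF.
have sqrtF y : Num.sqrt (F y) = expR (2^-1 * V y).
  by rewrite -powR12_sqrt ?ltW // /powR gt_eqF.
have AAE : AA = fun y => - L V y.
  by apply/funext => y; rewrite /AA laplacian_weighted.
(* The logarithm of the factor of [Psi] in [P]; [sqrt F = exp (V / 2)] contributes the 1/2 in
   [phi]. *)
pose g y := kappa * expR (a * V y) + 2^-1 * V y.
have sexpV : smooth (fun y => expR (a * V y)).
  by apply: smooth_expR; apply: smoothM => //; exact: smooth_cst.
have sg : smooth g.
  by apply: smoothD; apply: smoothM => //; exact: smooth_cst.
have PE : P = fun y => expR (g y) * Psi y.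
  by apply/funext => y; rewrite /P /g powF sqrtF expRD.
rewrite (laplacian_weighted _ (fun e => D0 e x)) //; last first.
  by rewrite PE; apply: smoothM => //; exact: smooth_expR.
rewrite PE weighted_laplacianM //; last exact: smooth_expR.
rewrite weighted_laplacian_expR //.
set e := expR (a * V x).
pose t := a * kappa * e; pose phi := t + 2^-1.
have dg i : partial i g x = phi * partial i V x.
  rewrite partialD ?partialZ ?partial_expR ?partialZ //; try exact: smooth_diff.
  - by rewrite /phi /t /e; ring.
  - by apply/smooth_diff/smoothM => //; exact: smooth_cst.
  - by apply/smooth_diff/smoothM => //; exact: smooth_cst.
  - by apply/smooth_diff/smoothM => //; exact: smooth_cst.
have deg i : partial i (fun y => expR (g y)) x = (expR (g x) * phi) * partial i
  V x.
  by rewrite partial_expR ?dg ?mulrA //; exact: smooth_diff.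
rewrite (inner_scalel _ _ deg) (inner_scalel _ _ dg) (inner_scaler sf _ dg).
have sV0 : @smooth R n (fun=> 0) by exact: smooth_cst.
have Lg : L g x = phi * L V x + a ^+ 2 * kappa * e * Psi x.
  rewrite weighted_laplacian_lincomb // weighted_laplacian_expR //; last first.
    by apply: smoothM => //; exact: smooth_cst.
  have daV i : partial i (fun y => a * V y) x = a * partial i V x.
    by rewrite partialZ //; exact: smooth_diff.
  rewrite (inner_scalel _ _ daV) (inner_scaler sf _ daV).
  (* Scaling is the linear combination rule with a zero second term. *)
  rewrite (_ : (fun y => a * V y) = fun y => a * V y + 0 * 0); last first.
    by apply/funext => y; rewrite mul0r addr0.
  rewrite (weighted_laplacian_lincomb _ _ a 0 x sV sV0) mul0r addr0.
  by rewrite -/Psi /phi /t /e; ring.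
rewrite Lg -/(Psi x) -/Psi.
have PsiE : Psi x = \sum_j partial j V x * gradient f V j x by exact: innerE.
have [B GB] := inv_hess_factor x.
pose r : 'rV[R]_n := \row_j partial j V x.
have Xr i : (r *m (B^T *m B)) 0 i = gradient f V i x.
  rewrite -GB mxE; apply: eq_bigr => j _.
  by rewrite (inv_hess_sym sf) mxE mulrC.
have rX : \sum_i r 0 i * (r *m (B^T *m B)) 0 i = Psi x.
  by rewrite PsiE; apply: eq_bigr => i _; rewrite Xr mxE.
have quadE (S : 'M[R]_n) :
    \sum_i \sum_j (r *m (B^T *m B)) 0 i * (r *m (B^T *m B)) 0 j * S i j =
    \sum_i \sum_j gradient f V i x * gradient f V j x * S i j.
  by apply: eq_bigr => i _; apply: eq_bigr => j _; rewrite !Xr.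
(* [Psi] is the sum of squares [|r B^T|^2], so it is positive where it does not vanish. *)
have Psi_gt0 : 0 < Psi x.
  rewrite lt0r Psi0 -rX /= mulmxA.
  rewrite (_ : \sum_i _ = \sum_i (r *m B^T) 0 i ^+ 2).
    by apply: sumr_ge0 => i _; exact: sqr_ge0.
  transitivity ((r *m (B^T *m B) *m r^T) 0 0).
    rewrite mxE mulmxA; apply: eq_bigr => i _.
    by rewrite [r^T _ _]mxE mulrC.
  rewrite mulmxA -mulmxA (_ : B *m r^T = (r *m B^T)^T); last first.
    by rewrite trmx_mul trmxK.
  rewrite mxE; apply: eq_bigr => i _.
  by rewrite [(r *m B^T)^T _ _]mxE expr2.
(* The two squares: [la = phi] for the covariant Hessian, [la = 2 * t] for the ordinary one. *)
have h1 := @trace_rank1_ge0 _ _ B (cov_hess f V x) r phi (cov_hess_tr sf sV x).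
have h2 := @trace_rank1_ge0 _ _ B (hess V x) r (2 * t) (hess_tr x sV).
rewrite /= quadE rX -GB in h1; rewrite /= quadE rX -GB in h2.
have kE : \sum_k \sum_j gradient f V k x * gradient f V j x *
      partial k (partial j V) x =
    \sum_i \sum_j gradient f V i x * gradient f V j x * hess V x i j.
  by apply: eq_bigr => i _; apply: eq_bigr => j _; rewrite hessE.
have VPsi : inner f V Psi x =
    \sum_i \sum_j gradient f V i x * gradient f V j x * cov_hess f V x i j
    + \sum_i \sum_j gradient f V i x * gradient f V j x * hess V x i j.
  rewrite (inner_sym sf) inner_gradient -big_split /=; apply: eq_bigr => i _.
  rewrite (partial_inner_hess sf sV f0) mulr_sumr -big_split /=;
    apply: eq_bigr => j _.
  by rewrite hessE (partialC i j sV); ring.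
have AV : inner f AA V x = - \sum_k gradient f V k x * partial k (L V) x.
  rewrite inner_gradient AAE -sumrN; apply: eq_bigr => k _.
  by rewrite partialN ?mulrN //; exact: smooth_diff.
have boch := bochner sf sV f0 DE D0 dV x.
rewrite chess_norm2E //.
have sq : \sum_e dlog_deriv f D x V e ^+ 2 =
    \sum_e ((D e x)^-1 * \sum_b gradient f V b x * partial b (D e) x) ^+ 2 by
      [].
rewrite sq {sq}; rewrite -/Psi kE in boch; rewrite boch VPsi AV normrN powF -/e.
rewrite AAE.
have : 0 <= \sum_e ((D e x)^-1 * \sum_b gradient f V b x * partial b (D e) x)
  ^+ 2.
  by apply: sumr_ge0 => b _; exact: sqr_ge0.
move: h1 h2.
set N2 := \sum_e _ ^+ 2.
set sxx := \sum_i \sum_j _ * _ * cov_hess _ _ _ i j.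
set kxx := \sum_i \sum_j _ * _ * hess V x i j.
set trS := \tr (G x *m cov_hess f V x *m _).
set trK := \tr (G x *m hess V x *m _).
set Y := \sum_k gradient f V k x * partial k (L V) x.
set eg := expR (g x); set LVx := L V x.
have eg0 : 0 < eg := expR_gt0 _.
move: Psi_gt0; move: (Psi x) => q q0 h1 h2 h3.
rewrite (_ : (eg * _ + _ + _) / (eg * q) =
  (2 * Y + trS + trK - kxx + N2 + phi * LVx * q + a ^+ 2 * kappa * e * q ^+ 2
   + phi ^+ 2 * q ^+ 2 + 2 * phi * (sxx + kxx)) / q); last first.
  by field; rewrite !gt_eqF.
rewrite -subr_ge0.
rewrite (_ : _ - _ = ((2 * Y + trS + trK - kxx + N2 + phi * LVx * q + a ^+ 2 *
  kappa * e * q ^+ 2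
   + phi ^+ 2 * q ^+ 2 + 2 * phi * (sxx + kxx)) - ((trK + N2) / 2 +
    (a ^+ 2 * kappa * e * q ^+ 2 - 2 * t ^+ 2 * q ^+ 2) - 2 * `|Y| + phi * LVx
      * q)) / q);
  last by rewrite /phi /t; field; rewrite gt_eqF.
apply: divr_ge0; last exact: ltW.
have hY : - Y <= `|Y| by rewrite -normrN ler_norm.
have phit : phi = t + 2^-1 by [].
(* The numerator is the form in [h1], plus half the form in [h2], plus [N2 / 2 + 2 * (Y + |Y|)]. The
   coefficients of [kxx] agree because [2 * phi - 1 = 2 * t]. *)
move: h1 h2; rewrite phit; lra.
Qed.

End interior.

(** * Surjectivity of the gradient of a symplectic potential *)

Lemma derive_approx (R : realType) (V : normedModType R) (F : V -> R) (x v : V)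
    (e : R) : derivable F x v -> 0 < e ->
  exists2 d : R, 0 < d & forall h, h != 0 -> `|h| < d ->
    `|h^-1 * (F (x + h *: v) - F x) - 'D_v F x| <= e.
Proof.
move=> dF e0; have /cvgrPdist_le/(_ _ e0) := dF.
move=> /nbhs_ballP[d d0 H]; exists d => // h h0 hd.
have : ball (0 : R) d h by rewrite -ball_normE /= sub0r normrN.
by rewrite (addrC x) distrC; move=> /H/(_ h0).
Qed.

Lemma derive_local_max (R : realType) (V : normedModType R) (F : V -> R)
    (x v : V) (d : R) : derivable F x v -> 0 < d ->
  (forall h, `|h| < d -> F (x + h *: v) <= F x) -> 'D_v F x = 0.
Proof.
move=> dF d0 Fmax; apply/eqP; rewrite -normr_le0.
apply/ler_addgt0Pr => e e0; rewrite add0r.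
have [d' d'0 H] := derive_approx dF e0.
pose h := Num.min d d' / 2.
have h0 : 0 < h by rewrite divr_gt0 // lt_min d0.
have hm : h < Num.min d d' by rewrite ltr_pdivrMr // ltr_pMr ?ltr1n // lt_min
  d0.
have [hd hd'] : h < d /\ h < d' by move: hm; rewrite lt_min => /andP[].
have {}H1 : `|h^-1 * (F (x + h *: v) - F x) - 'D_v F x| <= e.
  by apply: H; rewrite ?gt_eqF // gtr0_norm.
have {}H2 : `|(- h)^-1 * (F (x + (- h) *: v) - F x) - 'D_v F x| <= e.
  by apply: H; rewrite ?oppr_eq0 ?gt_eqF // normrN gtr0_norm.
have M1 : F (x + h *: v) - F x <= 0 by rewrite subr_le0 Fmax // gtr0_norm.
have M2 : F (x + (- h) *: v) - F x <= 0.
  by rewrite subr_le0 Fmax // normrN gtr0_norm.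
have Q1 : h^-1 * (F (x + h *: v) - F x) <= 0.
  by rewrite pmulr_rle0 // invr_gt0.
have Q2 : 0 <= (- h)^-1 * (F (x + (- h) *: v) - F x).
  by rewrite mulr_le0 // invr_le0 oppr_le0 ltW.
move: H1 H2; rewrite !ler_norml; lra.
Qed.

Lemma derive_ge0 (R : realType) (V : normedModType R) (F : V -> R)
    (x v : V) : derivable F x v ->
  (forall h, 0 < h -> F x <= F (x + h *: v)) -> 0 <= 'D_v F x.
Proof.
move=> dF Fx; rewrite leNgt; apply/negP => D0.
have [|d d0 H] := @derive_approx _ _ _ _ _ (- 'D_v F x / 2) dF.
  by rewrite divr_gt0 // oppr_gt0.
pose h := d / 2.
have h0 : 0 < h by rewrite divr_gt0.
have {}H : `|h^-1 * (F (x + h *: v) - F x) - 'D_v F x| <= - 'D_v F x / 2.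
  by apply: H; rewrite ?gt_eqF // gtr0_norm // ltr_pdivrMr // ltr_pMr // ltr1n.
have : 0 <= h^-1 * (F (x + h *: v) - F x).
  by rewrite pmulr_rge0 ?invr_gt0 // subr_ge0 Fx.
move: H; rewrite ler_norml; lra.
Qed.

(** For [a > 0] the increment is at most linear in [t], by [ln z - ln a <= z / a - 1] and
    [t ^+ 2 <= t]. For [a = 0] an extra [t s ln t] appears, whose slope at 0 is [-oo]. *)
Lemma xlnx_increment (R : realType) (a s t : R) : 0 <= a -> 0 < s -> 0 < t <= 1
  ->
  (a + t * (s - a)) * ln (a + t * (s - a)) - a * ln a <=
  t * (if a == 0 then s * ln s else (s - a) + (s - a) ^+ 2 / a + (s - a) * ln a)
  + (if a == 0 then t * s * ln t else 0).
Proof.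
move=> a0 s0 /andP[t0 t1].
have [->|an0] := eqVneq a 0.
  rewrite add0r subr0 mul0r subr0 lnM ?posrE //.
  by rewrite le_eqVlt; apply/orP; left; apply/eqP; ring.
have {a0 an0} a0 : 0 < a by rewrite lt0r an0.
rewrite addr0; set z := a + t * (s - a).
have z0 : 0 < z.
  rewrite /z (_ : _ + _ = (1 - t) * a + t * s); last by ring.
  by rewrite ltr_wpDl ?mulr_gt0 // mulr_ge0 ?subr_ge0 // ltW.
have lnz : ln z - ln a <= z / a - 1.
  rewrite -ln_div ?posrE //.
  have := @le_ln1Dx _ (z / a - 1); rewrite (addrC 1) subrK; apply.
  by rewrite ltrBrDl addrN divr_gt0.
rewrite (_ : z * ln z - a * ln a = z * (ln z - ln a) + (z - a) * ln a);
  last by ring.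
apply: (@le_trans _ _ (z * (z / a - 1) + (z - a) * ln a)).
  by rewrite lerD2r ler_wpM2l // ltW.
rewrite (_ : z * _ + _ = t * ((s - a) + t * ((s - a) ^+ 2 / a) + (s - a) * ln
  a)).
  apply: ler_wpM2l; first exact: ltW.
  rewrite lerD2r lerD2l ler_piMl //.
  by rewrite divr_ge0 ?sqr_ge0 // ltW.
by rewrite /z; field; rewrite gt_eqF.
Qed.

Section dot.
Variables (R : realType) (n : nat).
Implicit Types (x y z : 'rV[R]_n).

Lemma dotDl x y z : dot (x + y) z = dot x z + dot y z.
Proof. by rewrite -big_split; apply: eq_bigr => i _; rewrite mxE mulrDl. Qed.

Lemma dotC x y : dot x y = dot y x.
Proof. by apply: eq_bigr => i _; rewrite mulrC. Qed.

Lemma dotDr x y z : dot x (y + z) = dot x y + dot x z.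
Proof. by rewrite dotC dotDl !(dotC _ x). Qed.

Lemma dotZl (c : R) x y : dot (c *: x) y = c * dot x y.
Proof. by rewrite mulr_sumr; apply: eq_bigr => i _; rewrite mxE mulrA. Qed.

Lemma dotNl x y : dot (- x) y = - dot x y.
Proof. by rewrite -scaleN1r dotZl mulN1r. Qed.

Lemma dotZr (c : R) x y : dot x (c *: y) = c * dot x y.
Proof. by rewrite dotC dotZl dotC. Qed.

Lemma dot_delta x i : dot x (delta_mx 0 i) = x 0 i.
Proof.
rewrite /dot (bigD1 i) //= mxE !eqxx mulr1 big1 ?addr0 // => j ji.
by rewrite mxE (negPf ji) mulr0.
Qed.

Lemma derive_dot x y v : 'D_v (dot x) y = dot x v.
Proof.
apply: cvg_lim => //=; apply: cvg_near_cst; near=> h.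
have h0 : h != 0 by near: h; exact: nbhs_dnbhs_neq.
by rewrite dotDr addrK dotZr [_ *: _]mulrA mulVf // mul1r.
Unshelve. all: by end_near. Qed.

Lemma smooth_dot x : smooth (dot x).
Proof.
apply: smooth_sum => i _; apply: smoothM;
  [exact: smooth_cst|exact: smooth_coord].
Qed.

End dot.

Section surjectivity.
Variables (R : realType) (n d : nat) (N : 'M[R]_(d, n)) (b : 'rV[R]_d).
Variables (u f : 'rV[R]_n -> R).
Hypothesis Delta_neq0 : polytope N b !=set0.
Hypothesis Delta_compact : compact (closure (polytope N b)).
Hypothesis hu : symplectic_potential N b u.
Hypothesis hf : legendre (polytope N b) u f.

Local Notation Delta := (polytope N b).

Let smooth_delta l : smooth (delta N b l).
Proof. by apply: smoothD; [exact: smooth_dot|exact: smooth_cst]. Qed.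

Lemma closure_polytope_ge0 xi l : closure Delta xi -> 0 <= delta N b l xi.
Proof.
move=> cxi; rewrite leNgt; apply/negP => l0.
have near_lt : \forall eta \near xi, delta N b l eta < 0.
  have cd : delta N b l eta @[eta --> xi] --> delta N b l xi.
    exact: smooth_continuous.
  exact: (cvgr_lt _ cd _ l0).
have [eta [/(_ l) e1 /= e2]] := cxi _ near_lt.
by move: (lt_trans e1 e2); rewrite ltxx.
Qed.

Lemma polytope_near xi : Delta xi -> \forall eta \near xi, Delta eta.
Proof.
move=> Dxi; apply: (@filter_forall _ _ (fun l eta => 0 < delta N b l eta)
  (nbhs xi) _) => l.
have cd : delta N b l eta @[eta --> xi] --> delta N b l xi.
  exact: smooth_continuous.
exact: (cvgr_gt _ cd _ (Dxi l)).
Qed.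

Lemma delta_segment l xi eta (t : R) :
  delta N b l (xi + t *: (eta - xi)) =
  delta N b l xi + t * (delta N b l eta - delta N b l xi).
Proof.
rewrite /delta dotDr dotZr dotDr -[in dot _ (- xi)]scaleN1r dotZr; ring.
Qed.

Lemma polytope_segment xi eta (t : R) : closure Delta xi -> Delta eta ->
  0 < t <= 1 -> Delta (xi + t *: (eta - xi)).
Proof.
move=> cxi Deta /andP[t0 t1] l; rewrite delta_segment.
rewrite (_ : _ + _ = (1 - t) * delta N b l xi + t * delta N b l eta);
  last by ring.
rewrite ltr_wpDl ?mulr_gt0 ?Deta // mulr_ge0 ?subr_ge0 //.
exact: closure_polytope_ge0.
Qed.

Lemma differentiable_guillemin xi : Delta xi -> differentiable (guillemin N b)
  xi.
Proof.
move=> Dxi; apply: differentiable_sumf => l; apply: differentiableM.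
  exact: smooth_diff.
by apply: differentiable_ln; [exact: smooth_diff|exact: Dxi].
Qed.

(** [u] is prescribed only on the closed polytope; at interior points it agrees nearby with
    [guillemin + w]. *)
Lemma derivable_potential xi v : Delta xi -> derivable u xi v.
Proof.
have [U [w [_ DO sw uw]]] := sp_smooth hu.
move=> Dxi; pose g eta := guillemin N b eta + w eta.
have gu eta : closure Delta eta -> g eta = u eta.
  by move=> ce; rewrite /g -uw // addrC subrK.
have dg : derivable g xi v.
  apply: derivableD; first exact/diff_derivable/differentiable_guillemin.
  by have [_] := sw [::] xi (DO _ (subset_closure Dxi)); exact.
apply: (near_eq_derivable _ dg); near=> eta; apply: gu; apply: subset_closure.
by near: eta; exact: polytope_near.
Unshelve. all: by end_near. Qed.

(* Moving inwards from a facet the entropy terms of [guillemin] give [u] the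
   slope [-oo], so a maximizer of [dot y - u] cannot lie on the boundary. *)
Lemma maximizer_interior y xi : closure Delta xi ->
  (forall eta, closure Delta eta -> dot y eta - u eta <= dot y xi - u xi) ->
  Delta xi.
Proof.
have [U [w [_ DO sw uw]]] := sp_smooth hu.
move=> cxi ximax l0; rewrite lt0r closure_polytope_ge0 // andbT.
apply/negP => /eqP xil0.
have [xi1 Dxi1] := Delta_neq0.
pose q := xi1 - xi.
have dw : derivable w xi q by have [_] := sw [::] xi (DO _ cxi); exact.
have [rho rho0 Hw] := derive_approx dw ltr01.
pose a l := delta N b l xi; pose s l := delta N b l xi1.
pose c l := if a l == 0 then s l * ln (s l)
  else (s l - a l) + (s l - a l) ^+ 2 / a l + (s l - a l) * ln (a l).
pose K := \sum_l c l + ('D_q w xi + 1).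
have s0 l : 0 < s l := Dxi1 l.
(* Maximality of [xi] against the point a fraction [t] of the way to [xi1], divided by [t]. Other
   facets through [xi] contribute multiples of [ln t <= 0] and are dropped. *)
have main t : 0 < t -> t <= 1 -> t < rho -> dot y q <= K + s l0 * ln t.
  move=> t_gt0 t1 td.
  have Dt : Delta (xi + t *: q) by apply: polytope_segment => //; rewrite t_gt0.
  have := ximax _ (subset_closure Dt).
  have eu : u (xi + t *: q) - u xi = guillemin N b (xi + t *: q) - guillemin N
    b xi
      + (w (xi + t *: q) - w xi).
    rewrite -!uw //; last exact: subset_closure.
    by ring.
  have Hg : guillemin N b (xi + t *: q) - guillemin N b xi <=
      t * \sum_l c l + t * (s l0 * ln t).
    rewrite /guillemin -sumrB.
    apply: (@le_trans _ _ (\sum_l (t * c l +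
        (if a l == 0 then t * s l * ln t else 0)))).
      apply: ler_sum => l _; rewrite delta_segment.
      by apply: xlnx_increment; rewrite ?t_gt0 ?closure_polytope_ge0.
    rewrite big_split /= -mulr_sumr lerD2l (bigD1 l0) //= /a xil0 eqxx.
    rewrite mulrA -[leRHS]addr0 lerD2l; apply: sumr_le0 => l _.
    case: ifP => // _; rewrite mulr_ge0_le0 ?ln_le0 //.
    by rewrite mulr_ge0 // ltW.
  have Hwt : w (xi + t *: q) - w xi <= t * ('D_q w xi + 1).
    have := Hw t; rewrite gt_eqF // gtr0_norm // => /(_ isT td).
    by rewrite ler_norml => /andP[_ h]; rewrite -ler_pdivrMl //; lra.
  rewrite dotDr dotZr => h.
  have : t * dot y q <= t * (K + s l0 * ln t).
    apply: (@le_trans _ _ (u (xi + t *: q) - u xi)); first by lra.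
    rewrite eu /K; lra.
  by rewrite ler_pM2l.
(* Makes [s l0 * ln t] at most [dot y q - K - 1], against [main]. *)
pose r := (dot y q - K - 1) / s l0.
pose t := Num.min (Num.min 1 (rho / 2)) (expR r).
have t_gt0 : 0 < t by rewrite !lt_min ltr01 expR_gt0 divr_gt0.
have [t1 td tr] : [/\ t <= 1, t < rho & t <= expR r].
  split; rewrite ?ge_min ?gt_min ?lexx ?orbT //=.
  by rewrite ltr_pdivrMr // ltr_pMr // ltr1n orbT.
have lnt : ln t <= r by rewrite -[r]expRK ler_ln ?posrE ?expR_gt0.
have := main t t_gt0 t1 td.
have : s l0 * ln t <= dot y q - K - 1.
  by rewrite mulrC -ler_pdivlMr.
lra.
Qed.

(** A maximizer of [dot y - u] exists by compactness and is interior, hence critical. Its maximality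
    stays in the conclusion because the supporting functions of [f] come from it. *)
Lemma gradient_surjective y : exists2 xi, Delta xi & grad u xi = y /\
  forall eta, closure Delta eta -> dot y eta - u eta <= dot y xi - u xi.
Proof.
have [||xi] := @EVT_max_rV _ _ (fun eta => dot y eta - u eta) _ _ Delta_compact.
- by have [xi Dxi] := Delta_neq0; exists xi; exact: subset_closure.
- move=> x; apply: continuousB; last exact: (sp_cont hu).
  apply: continuous_subspaceT; exact/smooth_continuous/smooth_dot.
rewrite inE => cxi ximax'.
have ximax eta : closure Delta eta -> dot y eta - u eta <= dot y xi - u xi.
  by move=> ce; apply: ximax'; rewrite inE.
have Dxi := maximizer_interior cxi ximax.
exists xi => //; split => //; apply/rowP => i; rewrite mxE.
have dy : derivable (dot y) xi (delta_mx 0 i).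
  exact/diff_derivable/smooth_diff/smooth_dot.
have du := @derivable_potential xi (delta_mx 0 i) Dxi.
have /nbhs_ballP[e e0 He] := polytope_near Dxi.
have max0 : 'D_(delta_mx 0 i) (dot y - u) xi = 0.
  apply: (@derive_local_max _ _ _ _ _ e) => //; first exact: derivableB.
  move=> h he; apply: ximax; apply: subset_closure; apply: He.
  rewrite -ball_normE /= opprD addNKr normrN normrZ.
  apply: le_lt_trans he; rewrite -[leRHS]mulr1 ler_wpM2l //.
  exact: delta_mx_norm_le.
rewrite deriveB // in max0; move/eqP: max0; rewrite subr_eq0 => /eqP du0.
by rewrite /pd -du0 derive_dot dot_delta.
Qed.

(** [legendre] prescribes [f] only on the range of [grad u]. Surjectivity makes [f y] the maximum of
    [dot y - u] for every [y], and a maximum of functions affine in [y] is supported by the one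
    attaining it. *)
Lemma legendre_support y : exists xi, forall y', f y + dot (y' - y) xi <= f y'.
Proof.
have [xi Dxi [gxi _]] := gradient_surjective y.
exists xi => y'; have [xi' Dxi' [gxi' max']] := gradient_surjective y'.
have := hf Dxi; rewrite gxi => ->; have := hf Dxi'; rewrite gxi' => ->.
have := max' _ (subset_closure Dxi).
by rewrite dotDl dotNl; lra.
Qed.

End surjectivity.

(** A support at [z] has slope ['D_v F z] along [v]. Adding the supports at [x] and [x + h *: v]
    shows that this slope does not decrease, so its derivative along [v] is non-negative. *)
Lemma supported_hess_psd (R : realType) (n : nat) (F : 'rV[R]_n -> R) :
  smooth F -> (forall x, exists eta, forall x', F x + dot (x' - x) eta <= F x')
    ->
  forall x y : 'rV[R]_n, 0 <= (y *m hess F x *m y^T) 0 0.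
Proof.
move=> sF supp x v.
have dF z : derivable F z v by exact/diff_derivable/smooth_diff.
have suppD z eta : (forall z', F z + dot (z' - z) eta <= F z') ->
    'D_v F z = dot eta v.
  move=> Hz; have dd : derivable (dot eta) z v.
    exact/diff_derivable/smooth_diff/smooth_dot.
  have : 'D_v (dot eta - F) z = 0.
    apply: (@derive_local_max _ _ _ _ _ 1) => //; first exact: derivableB.
    move=> h _; have := Hz (z + h *: v).
    rewrite (_ : z + h *: v - z = h *: v); last by rewrite addrC addKr.
    by rewrite dotC !fctE /= dotDr; lra.
  by rewrite deriveB // derive_dot => /eqP; rewrite subr_eq0 => /eqP.
have DE : 'D_v F = fun z => \sum_i v 0 i * partial i F z.
  by apply/funext => z; rewrite derive_pd //; exact: smooth_diff.
have sD : smooth ('D_v F).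
  rewrite DE; apply: smooth_sum => i _; apply: smoothM; first exact: smooth_cst.
  exact: smooth_partial.
have : 0 <= 'D_v ('D_v F) x.
  apply: derive_ge0; first exact/diff_derivable/smooth_diff.
  move=> h h0; have [eta He] := supp x; have [eta' He'] := supp (x + h *: v).
  rewrite (suppD _ _ He) (suppD _ _ He').
  have := He (x + h *: v); have := He' x.
  rewrite (_ : x - (x + h *: v) = (- h) *: v); last first.
    by rewrite opprD addNKr scaleNr.
  rewrite (_ : x + h *: v - x = h *: v); last by rewrite addrC addKr.
  rewrite !dotZl !(dotC v).
  by move=> H1 H2; rewrite -(ler_pM2l h0); lra.
rewrite derive_pd; last exact: smooth_diff.
rewrite -mulmxA mxE; congr (_ <= _); apply: eq_bigr => i _; congr (_ * _).
rewrite DE partial_sum; last first.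
  by move=> j; apply/smooth_diff/smoothM;
    [exact: smooth_cst|exact: smooth_partial].
rewrite mxE; apply: eq_bigr => j _.
by rewrite partialZ ?hessE ?mxE 1?mulrC //; exact/smooth_diff/smooth_partial.
Qed.

Lemma derive_mulmx (R : realType) (n : nat) (A : 'M[R]_n) (f : 'rV[R]_n -> R)
    (x v : 'rV[R]_n) :
  'D_v (fun y => f (y *m A)) x = 'D_(v *m A) f (x *m A).
Proof.
rewrite /derive (_ : (fun h : R => _) = (fun h : R =>
    h^-1 *: ((f \o shift (x *m A)) (h *: (v *m A)) - f (x *m A)))) //.
by apply/funext => h /=; rewrite mulmxDl -scalemxAl.
Qed.

Lemma dot_mulmx (R : realType) (n : nat) (A : 'M[R]_n) (x y : 'rV[R]_n) :
  dot (x *m A) y = dot x (y *m A^T).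
Proof.
rewrite /dot; under eq_bigr do rewrite mxE mulr_suml.
under [RHS]eq_bigr do rewrite mxE mulr_sumr.
rewrite exchange_big /=; apply: eq_bigr => i _; apply: eq_bigr => j _.
by rewrite mxE -mulrA; congr (_ * _); rewrite mulrC.
Qed.

(** * Smooth extensions and boundary values *)

Section log_section.
Variables (R : realType) (n k : nat).

(** The points of the open orbit with [z^i > 0] for [i <= k] and real [w^i] otherwise: a section of
    [log_coord] along which a function of [x] is read off from its extension. *)
Definition log_section (x : 'rV[R]_n) : chart_point R n :=
  (\row_i (if (i < k)%N then expR (x 0 i / 2) else x 0 i), 0).

Lemma log_sectionK x : log_coord k (log_section x) = x.
Proof.
apply/rowP => i; rewrite !mxE; case: (i < k)%N => //=.
by rewrite expr0n addr0 -expRM_natr divfK // expRK.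
Qed.

Lemma log_section_orbit x : in_open_orbit k (log_section x).
Proof. by move=> i ik; left; rewrite mxE ik gt_eqF // expR_gt0. Qed.

Lemma log_section_continuous : continuous log_section.
Proof.
move=> x; pose s1 (y : 'rV[R]_n) : 'rV[R]_n :=
  \row_i (if (i < k)%N then expR (y 0 i / 2) else y 0 i).
have c1 : s1 y @[y --> x] --> s1 x.
  apply/(@cvgrPdist_le _ _ _ (nbhs x) _) => e e0.
  have H : \forall y \near x, forall i, `|(s1 x - s1 y) 0 i| <= e.
    apply: (@filter_forall _ _ (fun i y => `|(s1 x - s1 y) 0 i| <= e)
      (nbhs x) _) => i.
    pose g (y : 'rV[R]_n) := if (i < k)%N then expR (y 0 i / 2) else y 0 i.
    have cg : continuous g.
      rewrite /g; case: (i < k)%N; last exact/smooth_continuous/smooth_coord.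
      apply/smooth_continuous/smooth_expR/smoothM; first exact: smooth_coord.
      exact: smooth_cst.
    have /cvgrPdist_le/(_ _ e0) := cg x.
    by apply: filterS => y; rewrite !mxE.
  by apply: filterS H => y Hy; apply: normr_row_le; [exact: (ltW e0)|exact: Hy].
exact: (cvg_pair c1 (@cvg_cst _ (0 : 'rV[R]_n) _ (nbhs x) _)).
Qed.

Lemma is_derive_from_line (V : normedModType R) (F : V -> R) (x v : V) (D : R) :
  is_derive (0 : R) (1 : R) (fun h => F (x + h *: v)) D -> is_derive x v F D.
Proof.
have e : (fun h : R => h^-1 *: (((fun h => F (x + h *: v)) \o shift (0 : R))
      (h *: (1 : R)) - F (x + (0 : R) *: v))) =
    (fun h : R => h^-1 *: ((F \o shift x) (h *: v) - F x)).
  apply/funext => h /=; rewrite scale0r !addr0 [h%:A]mulr1.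
  by rewrite (addrC x).
move=> [dF <-]; apply: DeriveDef; first by move: dF; rewrite /derivable e.
by rewrite /derive e.
Qed.

Let speed (i : 'I_n) (x : 'rV[R]_n) : R := if (i < k)%N then 2^-1 * expR (x 0 i
  / 2) else 1.

Let smooth_speed (i : 'I_n) : smooth (speed i).
Proof.
rewrite /speed; case: (i < k)%N; last exact: smooth_cst.
apply: smoothM; first exact: smooth_cst.
apply/smooth_expR/smoothM; [exact: smooth_coord|exact: smooth_cst].
Qed.

(** Moving [x] along a coordinate axis moves [log_section x] on a straight line reparametrized by
    [tau]; a one-variable chain rule suffices, and only directional derivatives of [Q] occur. *)
Lemma is_derive_log_section (Q : chart_point R n -> R) (i : 'I_n) x :
  (forall v p, derivable Q p v) ->
  is_derive x (delta_mx 0 i) (Q \o log_section)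
    (speed i x * 'D_((delta_mx 0 i, 0) : 'rV[R]_n * 'rV[R]_n) Q (log_section
      x)).
Proof.
move=> dQ; apply: is_derive_from_line.
pose v : 'rV[R]_n * 'rV[R]_n := (delta_mx 0 i, 0).
pose tau (h : R) : R :=
  if (i < k)%N then expR ((x 0 i + h) / 2) - expR (x 0 i / 2) else h.
have dtau : is_derive (0 : R) (1 : R) tau (speed i x).
  rewrite /tau /speed; case: (i < k)%N; last exact: is_derive_id.
  have dexp : is_derive (0 : R) (1 : R)
      (fun h : R => expR (x 0 i / 2 + h *: (2^-1 : R))) (2^-1 * expR (x 0 i /
        2)).
    have dif (y : R) : differentiable expR y by exact/derivable1_diffP.
    have dde (y r : R) : derivable expR y r by exact/diff_derivable.
    have := @is_derive_line _ R expR (x 0 i / 2) 2^-1 0 (dde _ _).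
    rewrite scale0r addr0 deriveE // diff1E // derive1E.
    by rewrite (@derive_val _ _ _ _ _ _ _ (is_derive_expR _)).
  rewrite (_ : (fun h => _) = (fun h : R => expR (x 0 i / 2 + h *: (2^-1 : R)))
    - cst (expR (x 0 i / 2))).
    by rewrite -[X in is_derive _ _ _ X]subr0; apply: is_deriveB.
  by apply/funext => h /=; rewrite mulrDl.
have tau0 : tau 0 = 0.
  by rewrite /tau addr0 subrr; case: (i < k)%N.
have dphi : is_derive (tau 0) (1 : R) (fun r => Q (log_section x + r *: v))
    ('D_v Q (log_section x)).
  have := @is_derive_line _ _ Q (log_section x) v (tau 0) (dQ _ _).
  by rewrite {2}tau0 scale0r addr0.
have -> : (fun h => (Q \o log_section) (x + h *: delta_mx 0 i)) =
    (fun r => Q (log_section x + r *: v)) \o tau.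
  apply/funext => h /=; congr (Q _).
  apply: injective_projections => /=; last by rewrite scaler0 addr0.
  apply/rowP => j; rewrite !mxE /tau; have [->|ij] := eqVneq j i.
    by rewrite eqxx !mulr1; case: (i < k)%N; rewrite // [RHS]addrCA subrr addr0.
  by rewrite !mulr0 !addr0.
rewrite mulrC; exact: is_derive1_comp.
Qed.

(** Induction on the order for all [Q] at once: a derivative of the composite is [speed] times the
    composite with a directional derivative of [Q]. [differentiable_pd] upgrades this to Frechet
    differentiability. *)
Lemma smooth_comp_log_section (Q : chart_point R n -> R) :
  smooth_on setT Q -> smooth (Q \o log_section).
Proof.
move=> sQ r; elim: r Q sQ => // r IH Q sQ.
have dQ v p : derivable Q p v by have [_] := sQ [::] p I; exact.
pose e i : 'rV[R]_n * 'rV[R]_n := (delta_mx 0 i, 0).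
have sDQ i : smooth_on setT ('D_(e i) Q).
  (* The head of the list is the outermost derivative, so the direction taken first is appended at
     the end. *)
  move=> vs p _; have := sQ (rcons vs (e i)) p I.
  suff -> : iter_derive (rcons vs (e i)) Q = iter_derive vs ('D_(e i) Q) by [].
  by elim: vs => //= v vs ->.
have pdQ i : pd i (Q \o log_section) =
    fun x => speed i x * ('D_(e i) Q \o log_section) x.
  apply/funext => x; have h := is_derive_log_section i x dQ.
  by rewrite /pd (@derive_val _ _ _ _ _ _ _ h).
split=> [x|i].
  apply: differentiable_pd => i.
    by move=> y; have [] := is_derive_log_section i y dQ.
  rewrite pdQ; apply: continuousM; first exact/smooth_continuous/smooth_speed.
  apply: continuous_comp; first exact: log_section_continuous.
  by have [] := sDQ i [::] (log_section x) I.
rewrite partialE pdQ; apply: diffkM; first exact: smooth_speed.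
exact: IH.
Qed.

Lemma smooth_extension_section (Q : 'rV[R]_n -> R) Qh x :
  smooth_extension k Q Qh -> Q x = Qh (log_section x).
Proof. by move=> [_ ->]; rewrite ?log_sectionK //;
  exact: log_section_orbit. Qed.

Lemma smooth_extensionW (Q : 'rV[R]_n -> R) Qh :
  smooth_extension k Q Qh -> smooth Q.
Proof.
move=> eQ; have [sQ _] := eQ.
rewrite (_ : Q = Qh \o log_section); first exact: smooth_comp_log_section.
by apply/funext => x; exact: smooth_extension_section.
Qed.

End log_section.

Section boundary_values.
Variables (R : realType) (n k : nat) (p : chart_point R n).

(** Vanishing coordinates are replaced by [t], which leaves the boundary at once. On the open orbit
    the path is constant, because there [value_at] gives a value and no continuity. *)
Definition orbit_path (t : R) : chart_point R n :=
  if `[< in_open_orbit k p >] then p else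
  p + t *: ((\row_i (if (p.1 0 i == 0) && (p.2 0 i == 0) then 1 else 0), 0)
    : 'rV[R]_n * 'rV[R]_n).

Lemma orbit_path_orbit t : 0 < t -> in_open_orbit k (orbit_path t).
Proof.
move=> t0 i ik; rewrite /orbit_path; case: ifPn => [/asboolP|_]; first exact.
rewrite /= !mxE; case: (eqVneq (p.1 0 i) 0) => [->|p1] /=.
  case: (eqVneq (p.2 0 i) 0) => [->|p2] /=; last by right; rewrite mulr0 addr0.
  by left; rewrite mulr1 add0r gt_eqF.
by left; rewrite mulr0 addr0.
Qed.

(** The path depends on [p] and [k] alone, so all quantities are approached simultaneously, and the
    limit is the same for every extension that may witness [value_at]. *)
Lemma value_at_cvg (Q : 'rV[R]_n -> R) c : value_at k Q p c ->
  Q (log_coord k (orbit_path t)) @[t --> 0^'+] --> c.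
Proof.
move=> [Qin Qout]; have [pin|pout] := pselect (in_open_orbit k p).
  rewrite (_ : (fun t => _) = fun=> c); first exact: cvg_cst.
  by apply/funext => t; rewrite /orbit_path asboolT // -Qin.
have [Qh [sQ eQ] ->] := Qout pout.
have ep t : orbit_path t = p + t *:
    ((\row_i (if (p.1 0 i == 0) && (p.2 0 i == 0) then 1 else 0), 0)
    : 'rV[R]_n * 'rV[R]_n).
  by rewrite /orbit_path asboolF.
have cp : Qh (orbit_path t) @[t --> (0 : R)] --> Qh p.
  have c0 : orbit_path t @[t --> (0 : R)] --> p.
    rewrite (_ : orbit_path = fun t => p + t *:
      ((\row_i (if (p.1 0 i == 0) && (p.2 0 i == 0) then 1 else 0), 0)
      : 'rV[R]_n * 'rV[R]_n)); last by apply/funext => t; exact: ep.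
    rewrite -[X in _ --> X]addr0; apply: cvgD; first exact: cvg_cst.
    rewrite -[X in _ --> X](scale0r ((\row_i (if (p.1 0 i == 0) && (p.2 0 i ==
      0) then 1 else 0), 0)
      : 'rV[R]_n * 'rV[R]_n)).
    apply: cvgZr_tmp; exact: cvg_id.
  by apply: continuous_cvg => //; have [] := sQ [::] p I.
apply: cvg_trans (cvg_at_right_filter cp).
apply: near_eq_cvg; near=> t; rewrite eQ //; apply: orbit_path_orbit.
by near: t; exact: nbhs_right_gt.
Unshelve. all: by end_near. Qed.

End boundary_values.

(** * Face charts *)

Lemma lattice_basis_unit (R : realType) (n : nat) (L A : 'M[R]_n) :
  L \in unitmx -> lattice_basis L A -> A \in unitmx.
Proof.
move=> uL [U uU ->]; rewrite unitmx_mul uL andbT.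
rewrite unitmxE det_map_mx; apply: rmorph_unit.
by rewrite -unitmxE.
Qed.

(** Gives [D_alpha] the form required by the Bochner formula, a constant combination of first
    derivatives of the potential; the inverse of [A] undoes the change of coordinates. *)
Lemma chart_D_partial (R : realType) (n m : nat) (M : 'I_m -> 'I_n -> R)
    (A : 'M[R]_n) (f : 'rV[R]_n -> R) (a : 'I_m) :
  A \in unitmx -> smooth (chart_potential A f) ->
  chart_D M A f a = fun x => \sum_i
    (2 * \sum_j M a j * invmx A j i) * partial i (chart_potential A f) x.
Proof.
move=> uA sfc; apply/funext => x; rewrite /chart_D /Droot.
have gE j : grad f (x *m A) 0 j =
    \sum_i invmx A j i * partial i (chart_potential A f) x.
  rewrite mxE /pd (_ : delta_mx 0 j = (delta_mx 0 j *m invmx A) *m A).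
    rewrite -derive_mulmx derive_pd; last exact: smooth_diff.
    by apply: eq_bigr => i _; rewrite -rowE mxE.
  by rewrite -mulmxA mulVmx // mulmx1.
under eq_bigr do rewrite gE mulr_sumr.
rewrite exchange_big /= mulr_sumr; apply: eq_bigr => i _.
rewrite -mulrA mulr_suml; congr (_ * _); apply: eq_bigr => j _.
by rewrite mulrA.
Qed.

Lemma sum_coord_dot (R : realType) (n k : nat) (c : 'rV[R]_n) (x : 'rV[R]_n) :
  \sum_(i < n | (i < k)%N) c 0 i * x 0 i =
  dot (\row_i (if (i < k)%N then c 0 i else 0)) x.
Proof.
rewrite big_mkcond; apply: eq_bigr => i _; rewrite mxE.
by case: ifP => _ //; rewrite mul0r.
Qed.

Lemma partial_dot (R : realType) (n : nat) (c : 'rV[R]_n) i x :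
  partial i (dot c) x = c 0 i.
Proof. by rewrite partialE /pd derive_dot dot_delta. Qed.

Lemma hess_sub_affine (R : realType) (n : nat) (F : 'rV[R]_n -> R) c e x :
  smooth F -> hess (fun y => F y - dot c y - e) x = hess F x.
Proof.
move=> sF; apply/matrixP => i j; rewrite !hessE.
have sd : smooth (dot c) := @smooth_dot _ _ c.
have -> : partial j (fun y => F y - dot c y - e) = fun y => partial j F y - c 0
  j.
  apply/funext => y; rewrite partialB ?partial_cst ?subr0.
  - by rewrite partialB ?partial_dot //; exact: smooth_diff.
  - by apply: smooth_diff; exact: smoothB.
  - exact: differentiable_cst.
by rewrite partialB ?partial_cst ?subr0 //; exact/smooth_diff/smooth_partial.
Qed.

(** Only [f_E] is known to extend; the potential itself is smooth because the two differ by an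
    affine function. *)
Lemma chart_potential_smooth (R : realType) (n k : nat) (A : 'M[R]_n)
    (c : 'rV[R]_n) (e : R) (f : 'rV[R]_n -> R) :
  smooth (face_potential k A c e f) -> smooth (chart_potential A f).
Proof.
move=> sfE; rewrite (_ : chart_potential A f = fun x =>
  face_potential k A c e f x +
    (dot (\row_i (if (i < k)%N then c 0 i else 0)) x + e)).
  apply: smoothD => //; apply: smoothD; last exact: smooth_cst.
  exact: smooth_dot.
by apply/funext => x; rewrite -sum_coord_dot /face_potential; ring.
Qed.

Lemma hess_face_potential (R : realType) (n k : nat) (A : 'M[R]_n)
    (c : 'rV[R]_n) (e : R) (f : 'rV[R]_n -> R) x :
  smooth (chart_potential A f) ->
  hess (face_potential k A c e f) x = hess (chart_potential A f) x.
Proof.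
move=> sfc; rewrite (_ : face_potential k A c e f = fun y =>
  chart_potential A f y - dot (\row_i (if (i < k)%N then c 0 i else 0)) y - e).
  exact: hess_sub_affine.
by apply/funext => y; rewrite -sum_coord_dot.
Qed.

(** The relation [dV] of the Bochner section: the exponential factor makes [lin j] equal to 1 for
    [j < k] and 0 otherwise. *)
Lemma partial_ln_FE (R : realType) (n m k : nat) (f : 'rV[R]_n -> R)
    (D : 'I_m -> 'rV[R]_n -> R) j x :
  smooth f -> (forall a, smooth (D a)) -> (forall x, 0 < FE k f D x) ->
  partial j (fun x => ln (FE k f D x)) x =
  \sum_i \sum_l invmx (hess f x) i l * partial j (partial i (partial l f)) x
  + dlog_weight D j x - (j < k)%:R.
Proof.
move=> sf sD F0.
pose lin x := dot (\row_(i < n) (if (i < k)%N then 1 else 0)) x : R.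
have slin : smooth lin by exact: smooth_dot.
have sexp : smooth (fun x => expR (- lin x)).
  by apply/smooth_expR/smoothN.
have sdet : smooth (fun x => \det (hess f x)).
  apply: smooth_det => a b;
    rewrite (_ : (fun x => _) = partial a (partial b f)).
    exact/smooth_partial/smooth_partial.
  by apply/funext => y; rewrite hessE.
have sprod : smooth (fun x => \prod_a D a x) by exact: smooth_prod.
have FEE : FE k f D = fun x => \det (hess f x) * expR (- lin x) * \prod_a D a x.
  apply/funext => y; rewrite /FE; congr (_ * expR (- _) * _).
  rewrite /lin /dot big_mkcond; apply: eq_bigr => i _; rewrite mxE.
  by case: ifP => _; rewrite ?mul1r ?mul0r.
have sF : smooth (FE k f D).
  by rewrite FEE; apply: smoothM => //; exact: smoothM.
have nz y : [/\ \det (hess f y) != 0, expR (- lin y) != 0 & \prod_a D a y != 0].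
  have := F0 y; rewrite FEE => /lt0r_neq0.
  by rewrite !mulf_eq0 !negb_or => /andP[/andP[-> ->] ->].
have f0 y : \det (hess f y) != 0 by have [] := nz y.
have [d0 e0 p0] := nz x.
rewrite partial_ln //; last exact: smooth_diff.
rewrite FEE partialM; [|by apply: smooth_diff;
  exact: smoothM|exact: smooth_diff].
rewrite partialM; [|exact: smooth_diff..].
rewrite partial_expR; last exact/smooth_diff/smoothN.
rewrite partialN; last exact: smooth_diff.
rewrite partial_dot mxE (partial_det_hess sf f0) partial_prod;
  last by move=> a; exact: smooth_diff.
have -> : \sum_a partial j (D a) x * \prod_(b | b != a) D b x =
    (\prod_a D a x) * dlog_weight D j x.
  rewrite mulr_sumr; apply: eq_bigr => a _.
  have Da : D a x != 0 by move: p0;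
    rewrite prodf_seq_neq0 => /allP/(_ a (mem_index_enum _)).
  by rewrite [in RHS](bigD1 a) //= mulrACA mulfV // mul1r mulrC.
rewrite (_ : (if (j < k)%N then 1 else 0) = (j < k)%:R :> R); last by case: ifP.
by field; rewrite d0 e0 p0.
Qed.

Lemma cvg_powR (R : realType) (T : Type) (Fi : set_system T) {FF : Filter Fi}
    (g : T -> R) (l a : R) : 0 < l -> g t @[t --> Fi] --> l ->
  g t `^ a @[t --> Fi] --> l `^ a.
Proof.
move=> l0 gl; have -> : l `^ a = expR (a * ln l) by rewrite /powR gt_eqF.
have cl : expR (a * ln (g t)) @[t --> Fi] --> expR (a * ln l).
  apply: continuous_cvg; first exact: continuous_expR.
  apply: cvgMl_tmp; apply: continuous_cvg gl; exact: continuous_ln.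
apply: cvg_trans cl; apply: near_eq_cvg.
have : \forall t \near Fi, 0 < g t by exact: (cvgr_gt _ gl _ l0).
by apply: filterS => t gt0; rewrite /powR gt_eqF.
Qed.

Theorem lemma6p2 (R : realType) (n hb m d k : nat)
  (g : vectType R) (br : g -> g -> g) (h s kK z : {vspace g})
  (Pi : (n + hb).-tuple 'Hom(subvs_of h, R^o))
  (RM : m.-tuple 'Hom(subvs_of h, R^o))
  (hflag : flag_data br s kK z Pi RM)
  (L : 'M[R]_n) (N : 'M[R]_(d, n)) (b : 'rV[R]_d)
  (hDelta : delzant L N b)
  (hpos : position_assumption (root_coef Pi RM) (polytope N b))
  (u f : 'rV[R]_n -> R)
  (hu : symplectic_potential N b u)
  (hf : legendre (polytope N b) u f)
  (E : set 'rV[R]_n) (hk : (k <= n)%N)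
  (hE : face_of_dim N b E (n - k))
  (A : 'M[R]_n) (c : 'rV[R]_n) (e : R)
  (hchart : face_chart L N b E k A c) :
  let fc := chart_potential A f in
  let D := chart_D (root_coef Pi RM) A f in
  let fE := face_potential k A c e f in
  let F := FE k fE D in
  (exists fEh, smooth_extension k fE fEh) ->
  (exists2 Fh, smooth_extension k F Fh & forall p, 0 < Fh p) ->
  forall (a kappa : R), 0 < a -> 0 < kappa ->
  let V := fun x => ln (F x) in
  let AA := fun x => - laplacian fc D V x in
  let Psi := inner fc V V in
  let P := fun x => expR (kappa * F x `^ a) * Num.sqrt (F x) * Psi x in
  forall (p : chart_point R n) (F0 AA0 Psi0 P0 boxP0 normV0 inAV0 : R),
    value_at k F p F0 ->
    value_at k AA p AA0 ->
    value_at k Psi p Psi0 ->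
    value_at k P p P0 ->
    value_at k (laplacian fc D P) p boxP0 ->
    value_at k (chess_norm2 fc D V) p normV0 ->
    value_at k (inner fc AA V) p inAV0 ->
    Psi0 != 0 ->
    boxP0 / P0 >=
      normV0 / (2 * Psi0)
      + a ^+ 2 * kappa * (1 - 2 * kappa * F0 `^ a) * F0 `^ a * Psi0
      - 2 * `|inAV0| / Psi0
      - (a * kappa * F0 `^ a + 2^-1) * AA0.

Proof.
move=> fc D fE F [fEh exE] [Fh exF Fh0] a kappa _ _ V AA Psi P.
move=> p F0 AA0 Psi0 P0 boxP0 normV0 inAV0 vF vAA vPsi vP vboxP vnorm vinAV
  Psi0_neq0.
have [latA _ _] := hchart.
have uA : A \in unitmx := lattice_basis_unit (dz_lattice hDelta) latA.
have sfc : smooth fc := chart_potential_smooth (smooth_extensionW exE).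
have DE b' : D b' = fun x => \sum_i
    (2 * \sum_j root_coef Pi RM b' j * invmx A j i) * partial i fc x.
  exact: chart_D_partial.
have FFE : F = FE k fc D.
  by apply/funext => x; rewrite /F /FE (hess_face_potential _ _ _ _ sfc).
have F_gt0 x : 0 < F x by rewrite (smooth_extension_section x exF).
have sF : smooth F := smooth_extensionW exF.
(* Both are factors of [F], so its positivity makes the Hessian invertible and every [D_alpha]
   non-zero. *)
have nz x : \det (hess fc x) != 0 /\ \prod_b' D b' x != 0.
  have := F_gt0 x; rewrite FFE /FE => /lt0r_neq0 F_neq0.
  by split; apply: contraNneq F_neq0 => ->; rewrite ?mul0r ?mulr0.
have f0 x : \det (hess fc x) != 0 by case: (nz x).
have D0 b' x : D b' x != 0.
  have [_] := nz x; rewrite prodf_seq_neq0 => /allP/(_ b' (mem_index_enum _)).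
  exact.
have sD b' : smooth (D b').
  rewrite DE; apply: smooth_sum => i _; apply: smoothM; first exact: smooth_cst.
  exact: smooth_partial.
have supp x : exists eta, forall x', fc x + dot (x' - x) eta <= fc x'.
  have [xi Hxi] := legendre_support (dz_nonempty hDelta) (dz_compact hDelta) hu
    hf
    (x *m A).
  by exists (xi *m A^T) => x'; rewrite -dot_mulmx mulmxBl; exact: Hxi.
have psd := supported_hess_psd sfc supp.
clear exE; clearbody F; clear fE; clearbody D fc.
have dV j x : partial j V x =
    \sum_i \sum_l invmx (hess fc x) i l * partial j (partial i (partial l fc)) x
    + dlog_weight D j x - (j < k)%:R.
  by subst F; exact: partial_ln_FE.
have ineq x := interior_inequality sfc sF F_gt0 f0 DE D0 psd dV a kappa (x :=
  x).
have cF := value_at_cvg vF; have cPsi := value_at_cvg vPsi.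
have cAA := value_at_cvg vAA; have cP := value_at_cvg vP.
have cbox := value_at_cvg vboxP; have cnorm := value_at_cvg vnorm.
have cin := value_at_cvg vinAV.
pose x t := log_coord k (orbit_path k p t).
(* Off the open orbit [F0] comes from some extension of [F]; uniqueness of the limit identifies it
   with the value of the positive extension [Fh]. *)
have F0_gt0 : 0 < F0.
  have vF' : value_at k F p (Fh p).
    by split=> [pin|_]; [case: exF => _ ->|exists Fh].
  by rewrite (cvg_unique _ cF (value_at_cvg vF')).
have cpow : F (x t) `^ a @[t --> 0^'+] --> F0 `^ a by exact: cvg_powR F0_gt0 cF.
(* [P0] is given separately from [F0] and [Psi0]; the limits tie them together, and the resulting
   [P0 != 0] lets the quotient pass to the limit. *)
have P0E : P0 = expR (kappa * F0 `^ a) * Num.sqrt F0 * Psi0.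
  have cexp : expR (kappa * F (x t) `^ a) @[t --> 0^'+] -->
      expR (kappa * F0 `^ a).
    exact: (continuous_cvg _ (@continuous_expR R _) (cvgMl_tmp cpow)).
  have csqrt : Num.sqrt (F (x t)) @[t --> 0^'+] --> Num.sqrt F0.
    exact: (continuous_cvg _ (@sqrt_continuous R F0) cF).
  exact: (cvg_unique _ cP (cvgM (cvgM cexp csqrt) cPsi)).
have P0_neq0 : P0 != 0.
  by rewrite P0E !mulf_neq0 // gt_eqF ?expR_gt0 ?sqrtr_gt0.
(* Near [t = 0] the path stays where [Psi] is non-zero, so the interior inequality holds along it
   and both sides converge. *)
apply: (ler_cvg_to _ (cvgM cbox (cvgV P0_neq0 cP))); last first.
  have : \forall t \near 0^'+, Psi (x t) != 0 by exact: cvgr_neq0 cPsi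
    Psi0_neq0.
  by apply: filterS => t; exact: ineq.
apply: cvgB (cvgB (cvgD _ _) _) _.
- apply: cvgM cnorm (cvgV _ (cvgMl_tmp cPsi)).
  by rewrite mulf_neq0.
- apply: cvgM (cvgM (cvgM (cvg_cst _) _) cpow) cPsi.
  exact: cvgB (cvg_cst _) (cvgMl_tmp cpow).
- exact: cvgM (cvgMl_tmp (cvg_norm cin)) (cvgV Psi0_neq0 cPsi).
- exact: cvgM (cvgD (cvgMl_tmp cpow) (cvg_cst _)) cAA.
Qed.
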